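(* Let $R$ be a complete discrete valuation ring of equal characteristic with maximal ideal $\mathfrak{p}$ and finite residue field $k=R/\mathfrak{p}$ with $|k|>9$, and let $n\ge2$. Let $H$ be a closed subgroup of $\mathrm{GL}_n(R)$ such that the image of $H$ in $\mathrm{GL}_n(k)$ contains $\mathrm{SL}_n(k)$ and such that the set $\mathrm{Tr}\,\mathrm{Ad}(H)=\{\mathrm{Tr}\,\mathrm{Ad}(h)\mid h\in H\}$ topologically generates the ring $R$. Then $H^{\mathrm{der}}=\mathrm{SL}_n(R)$.
   Context: $\mathrm{Ad}$ is the adjoint representation of $\mathrm{GL}_n$ on $\mathfrak{gl}_n$, $X\mapsto hXh^{-1}$, so $\mathrm{Tr}\,\mathrm{Ad}(h)\in R$. ''Topologically generates'' means the smallest closed subring of $R$ containing the set is $R$. $H^{\mathrm{der}}$ is the closure of the derived group of $H$. *)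

(* Defs.v *)
From HB Require Import structures.
From mathcomp Require Import all_boot all_order all_algebra.
Set Implicit Arguments. Unset Strict Implicit. Unset Printing Implicit Defensive.
Import Order.TTheory GRing.Theory Num.Theory.
Local Open Scope ring_scope.

Section DVR.
Variable R : idomainType.
Variable pi : R.

Definition inPow (m : nat) (x : R) : Prop := exists y : R, x = pi ^+ m * y.

Definition is_dvr : Prop :=
  [/\ pi != 0, pi \isn't a GRing.unit &
      forall x : R, x != 0 ->
        exists (u : R) (m : nat), u \is a GRing.unit /\ x = u * pi ^+ m].

Definition complete_dvr : Prop :=
  forall a : nat -> R,
    (forall m, exists N, forall i j, (N <= i)%N -> (N <= j)%N -> inPow m (a i - a j)) ->
    exists x, forall m, exists N, forall i, (N <= i)%N -> inPow m (x - a i).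

Definition residue_finite_card_gt (c : nat) : Prop :=
  exists s : seq R,
    [/\ (forall i j, (i < size s)%N -> (j < size s)%N ->
           inPow 1 (s`_i - s`_j) -> i = j),
        (forall x : R, exists2 y, y \in s & inPow 1 (x - y)) &
        (c < size s)%N].

Definition closedR (S : R -> Prop) : Prop :=
  forall x, (forall m, exists y, S y /\ inPow m (x - y)) -> S x.

Definition subringR (S : R -> Prop) : Prop :=
  [/\ S 1, forall x y, S x -> S y -> S (x - y) & forall x y, S x -> S y -> S (x * y)].

Definition top_generates (T : R -> Prop) : Prop :=
  forall S : R -> Prop, subringR S -> closedR S -> (forall x, T x -> S x) ->
    forall x, S x.

Variable n : nat.

Definition mclosure (S : 'M[R]_n -> Prop) (g : 'M[R]_n) : Prop :=
  forall m, exists y, S y /\ forall i j, inPow m (g i j - y i j).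

Definition GLn (g : 'M[R]_n) : Prop := g \in unitmx.

Definition closed_subgroup (H : 'M[R]_n -> Prop) : Prop :=
  [/\ forall h, H h -> GLn h,
      H 1%:M,
      forall g h, H g -> H h -> H (g *m h),
      forall h, H h -> H (invmx h) &
      forall g, mclosure H g -> H g].

Definition image_contains_SLk (H : 'M[R]_n -> Prop) : Prop :=
  forall A : 'M[R]_n, inPow 1 (\det A - 1) ->
    exists2 h, H h & forall i j, inPow 1 (h i j - A i j).

Definition TrAd (h : 'M[R]_n) : R :=
  \tr (lin_mx (fun X : 'M[R]_n => h *m X *m invmx h)).

Definition commg_mx (g h : 'M[R]_n) : 'M[R]_n :=
  g *m h *m invmx g *m invmx h.

Inductive derived (H : 'M[R]_n -> Prop) : 'M[R]_n -> Prop :=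
  | derived1 : derived H 1%:M
  | derivedC g h : H g -> H h -> derived H (commg_mx g h)
  | derivedM x y : derived H x -> derived H y -> derived H (x *m y).

Definition Hder (H : 'M[R]_n -> Prop) : 'M[R]_n -> Prop :=
  mclosure (derived H).

End DVR.

(* Main.v *)
Require Import Defs.
From HB Require Import structures.
From mathcomp Require Import all_boot all_fingroup all_order all_algebra all_field.
From mathcomp Require ring_quotient generic_quotient.
From mathcomp Require Import ring zify boolp.
Import GRing.Theory.
Local Open Scope ring_scope.
Set Implicit Arguments. Unset Strict Implicit. Unset Printing Implicit Defensive.

(** Let L_i(H) be the image in M_n(k) of the elements of H congruent to 1 modulo pi^i under 1 + pi^i Z |-> Z mod pi.  It is an additive group stable under conjugation by SL_n(k), so it contains sl_n(k) as soon as it contains a nonscalar matrix.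

    Suppose that L_1(H) consists of scalars.  The Frobenius s : x |-> x^|k| is an endomorphism of R lifting the identity of k and depending, modulo pi^2, only on x mod pi; hence h = s(h) (1 + pi Z_h) defines a 1-cocycle h |-> Z_h on the image of H with values in gl_n(k) modulo scalars.  For |k| > 9 this cocycle is a coboundary: average over the diagonal torus, then read off the torus weights on the root subgroups.  Therefore H is conjugate modulo pi^2, up to scalars, to s(H), and Tr Ad(H) lies in the closed proper subring of the x with s(x) = x mod pi^2, a contradiction.

    So L_1(H) contains sl_n(k), and commutators give L_1(H^der).  Brackets propagate this to all L_i(H^der), except for n = 2 in characteristic 2, where [sl_2, sl_2] is scalar and second-order terms are needed.  Successive approximation then yields every matrix of determinant 1. *)

(** * Elementary matrices *)

Section Elem.
Variables (K : comNzRingType) (n : nat).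
Implicit Types (A B : 'M[K]_n) (i j : 'I_n).

(** Tr Ad(h) = tr(h) tr(h^-1) does not change when h is multiplied by a scalar. This fits the
    assumption that L_1(H) is scalar, which determines Z_h only modulo scalars: the unknown factor 1
    + pi c in tr(h) meets 1 - pi c in tr(h^-1), and the product is 1 modulo pi^2. The Frobenius is
    precise enough because s(pi) vanishes modulo pi^2; for the same reason pi is not in the ring of
    all x with s(x) = x modulo pi^2, which is therefore proper. The bound on |k| comes from one
    point: the entry of the cocycle whose weight is opposite to its root subgroup is an additive f
    with f(c^2 b) = c^-2 f(b), and to exclude it in odd characteristic takes a nonroot of a
    polynomial of degree 9. The other torus arguments need only an element whose square or cube is
    not 1. On the side of H^der, leading terms of elements of determinant 1 have trace 0, so sl_n(k)
    is the most that a level can contain and exactly what approximation in SL_n(R) requires. *)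

Definition elem i j (b : K) : 'M[K]_n := 1%:M + b *: delta_mx i j.

Lemma mul_delta_l A i j r c : (delta_mx i j *m A) r c = (r == i)%:R * A j c.
Proof.
rewrite mxE (bigD1 j) //= big1 ?addr0 => [|l /negPf hl]; first by rewrite mxE eqxx andbT.
by rewrite mxE hl andbF mul0r.
Qed.

Lemma mul_delta_r A i j r c : (A *m delta_mx i j) r c = A r i * (c == j)%:R.
Proof.
rewrite mxE (bigD1 i) //= big1 ?addr0 => [|l /negPf hl]; first by rewrite mxE eqxx.
by rewrite mxE hl mulr0.
Qed.

Lemma elem_mull A i j b r c : (elem i j b *m A) r c = A r c + b * ((r == i)%:R * A j c).
Proof. by rewrite mulmxDl mul1mx -scalemxAl 2!mxE mul_delta_l. Qed.

Lemma elem_mulr A i j b r c : (A *m elem i j b) r c = A r c + b * (A r i * (c == j)%:R).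
Proof. by rewrite mulmxDr mulmx1 -scalemxAr 2!mxE mul_delta_r. Qed.

Lemma elem_conj A i j b r c : (elem i j b *m A *m elem i j (- b)) r c =
  A r c + b * ((r == i)%:R * A j c) - b * (A r i * (c == j)%:R)
  - b ^+ 2 * ((r == i)%:R * (c == j)%:R) * A j i.
Proof. rewrite elem_mulr !elem_mull; ring. Qed.

Lemma elem0 i j : elem i j 0 = 1%:M.
Proof. by rewrite /elem scale0r addr0. Qed.

Lemma elemD i j a b : i != j -> elem i j a *m elem i j b = elem i j (a + b).
Proof.
move=> hij; rewrite /elem mulmxDr mulmx1 -scalemxAr mulmxDl mul1mx -scalemxAl.
by rewrite mul_delta_mx_0 1?eq_sym // scaler0 addr0 scalerDl addrA.
Qed.

Lemma elemN i j b : i != j -> elem i j b *m elem i j (- b) = 1%:M.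
Proof. by move=> hij; rewrite elemD // subrr elem0. Qed.

Lemma elemNl i j b : i != j -> elem i j (- b) *m elem i j b = 1%:M.
Proof. by move=> hij; rewrite elemD // addNr elem0. Qed.

Lemma det_elem i j b : i != j -> \det (elem i j b) = 1.
Proof.
move=> hij; suff up : forall (r c : 'I_n) , r != c -> (r < c)%N -> \det (elem r c b) = 1.
  case: (ltngtP i j) => [h|h|/val_inj/eqP]; [exact: up| |by rewrite (negPf hij)].
  rewrite -det_tr -(up _ _ _ h) 1?eq_sym //; congr (\det _).
  by rewrite /elem linearD /= trmx1 linearZ /= trmx_delta.
move=> r c hrc hlt; rewrite -det_tr det_trig; last first.
  apply/is_trig_mxP => x y hxy; rewrite !mxE.
  case: eqP => [hyx|_]; first by rewrite hyx ltnn in hxy.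
  case: eqP => [hyr|]; last by rewrite mulr0 addr0.
  case: eqP => [hxc|]; last by rewrite mulr0 addr0.
  by move: hxy; rewrite hyr hxc ltnNge ltnW.
rewrite big1 // => x _; rewrite !mxE eqxx.
case: eqP => [->|]; last by rewrite mulr0 addr0.
by rewrite (negPf hrc) mulr0 addr0.
Qed.

End Elem.

Section InvElem.
Variables (K : comUnitRingType) (n : nat).
Lemma invmx_unique (A B : 'M[K]_n) : A *m B = 1%:M -> invmx A = B.
Proof. by move=> AB; have [/mulKmx hA _] := mulmx1_unit AB; rewrite -[B]hA AB mulmx1. Qed.

Lemma invmx_elem (i j : 'I_n) (b : K) : i != j -> invmx (elem i j b) = elem i j (- b).
Proof. by move=> hij; apply: invmx_unique; rewrite elemN. Qed.

Lemma invmxM (A B : 'M[K]_n) : A \in unitmx -> B \in unitmx -> invmx (A *m B) = invmx B *m invmx A.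
Proof.
by move=> uA uB; apply: invmx_unique; rewrite -mulmxA (mulmxA B) mulmxV // mul1mx mulmxV.
Qed.

Lemma det1_unit (A : 'M[K]_n) : \det A = 1 -> A \in unitmx.
Proof. by move=> h; rewrite unitmxE h unitr1. Qed.

Lemma invmx1 : invmx 1%:M = 1%:M :> 'M[K]_n.
Proof. by apply: invmx_unique; rewrite mulmx1. Qed.
End InvElem.

(** * Generation of SL_n over a field by elementary matrices *)

Section Generation.
Variable K : fieldType.

(** Closure under products is enough, since the inverse of an elementary matrix is elementary.
    Induction on n: a matrix with corner entry 1 is a lower unipotent block, times diag(1, Schur
    complement), times an upper unipotent block, and the Schur complement has determinant 1. *)
Lemma sl_generated n (P : 'M[K]_n -> Prop) :
  P 1%:M -> (forall A B, P A -> P B -> P (A *m B)) ->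
  (forall i j b, i != j -> P (elem i j b)) ->
  forall g, \det g = 1 -> P g.
Proof.
elim: n => [|n IH] in P *; first by move=> P1 _ _ g _; rewrite (_ : g = 1%:M) //; apply/matrixP=> [[]].
move=> P1 PM PE g.
have Pl i j b h : i != j -> P (elem i j b *m h) -> P h.
  move=> hij hP; rewrite -[h]mul1mx -(elemNl b hij) -mulmxA.
  by apply: (PM) => //; apply: PE.
have P00 h : \det h = 1 -> h 0 0 = 1 -> P h.
  rewrite -[n.+1]/(1 + n)%N in P P1 PM PE Pl h * => dh h00.
  set u := ursubmx h; set v := dlsubmx h; set w := drsubmx h.
  have e1 : ulsubmx h = 1%:M.
    apply/matrixP => x y; rewrite !ord1 !mxE eqxx -h00; congr (h _ _); exact: val_inj.
  have PL x : P (block_mx 1%:M 0 x 1%:M).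
    rewrite (matrix_sum_delta x).
    apply: (big_ind (fun x => P (block_mx 1%:M 0 x 1%:M))).
    - by rewrite -scalar_mx_block.
    - move=> a b Pa Pb; have := PM _ _ Pa Pb.
      by rewrite mulmx_block !(mulmx1, mul1mx, mulmx0, mul0mx, addr0, add0r).
    - move=> i _; rewrite big_ord1.
      have /PE-/(_ (x i 0)) : rshift 1 i != lshift n (0 : 'I_1) by rewrite eq_rlshift.
      congr P; apply/matrixP=> a b; rewrite /elem scalar_mx_block.
      rewrite -[delta_mx (rshift _ _) _]submxK scale_block_mx add_block_mx.
      congr (block_mx _ _ _ _ _ _); apply/matrixP=> c d;
        rewrite !mxE ?(eq_lrshift, eq_rlshift, eq_rshift, eq_lshift) ?andbF ?mulr0 ?addr0 ?add0r //=.
  have PU x : P (block_mx 1%:M x 0 1%:M).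
    rewrite (matrix_sum_delta x) big_ord1.
    apply: (big_ind (fun x => P (block_mx 1%:M x 0 1%:M))).
    - by rewrite -scalar_mx_block.
    - move=> a b Pa Pb; have := PM _ _ Pa Pb.
      by rewrite mulmx_block !(mulmx1, mul1mx, mulmx0, mul0mx, addr0, add0r) addrC.
    - move=> i _.
      have /PE-/(_ (x 0 i)) : lshift n (0 : 'I_1) != rshift 1 i by rewrite eq_lrshift.
      congr P; apply/matrixP=> a b; rewrite /elem scalar_mx_block.
      rewrite -[delta_mx (lshift _ _) _]submxK scale_block_mx add_block_mx.
      congr (block_mx _ _ _ _ _ _); apply/matrixP=> c d;
        rewrite !mxE ?(eq_lrshift, eq_rlshift, eq_rshift, eq_lshift) ?andbF ?mulr0 ?addr0 ?add0r //=.
  have eh : h = block_mx 1%:M 0 v 1%:M *m block_mx 1%:M 0 0 (w - v *m u) *m block_mx 1%:M u 0 1%:M.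
    rewrite !mulmx_block !(mulmx1, mul1mx, mulmx0, mul0mx, addr0, add0r) addrC subrK -e1.
    by rewrite submxK.
  rewrite eh; apply: (PM _ _ _ (PU _)); apply: (PM) => //.
  apply: (IH (fun w => P (block_mx 1%:M 0 0 w))).
  - by rewrite -scalar_mx_block.
  - move=> a b Pa Pb; have := PM _ _ Pa Pb.
    by rewrite mulmx_block !(mulmx1, mul1mx, mulmx0, mul0mx, addr0, add0r).
  - move=> i j b hij.
    have /PE-/(_ b) : rshift 1 i != rshift 1 j by rewrite eq_rshift.
    congr P; apply/matrixP=> c d; rewrite /elem scalar_mx_block.
    rewrite -[delta_mx _ _]submxK scale_block_mx add_block_mx.
    congr (block_mx _ _ _ _ _ _); apply/matrixP=> ? ?;
      rewrite !mxE ?(eq_lrshift, eq_rlshift, eq_rshift, eq_lshift) ?andbF ?mulr0 ?addr0 ?add0r //=.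
  - by move: dh; rewrite eh !det_mulmx !det_lblock det_ublock !det1 !mul1r mulr1.
have Pr h r : \det h = 1 -> r != 0 -> h r 0 != 0 -> P h.
  move=> dh r0 hr; apply: (Pl 0 r ((1 - h 0 0) / h r 0)); first by rewrite eq_sym.
  apply: P00; first by rewrite det_mulmx det_elem ?mul1r // eq_sym.
  by rewrite elem_mull eqxx mul1r divfK // addrC subrK.
move=> dg; case: (pickP (fun r => (r != 0) && (g r 0 != 0))) => [r /andP[r0 gr]|h0].
  exact: Pr gr.
have g0 r : r != 0 -> g r 0 = 0 by move=> r0; move: (h0 r); rewrite r0 => /negbFE/eqP.
have g00 : g 0 0 != 0.
  apply/eqP => g00; have /eqP := dg; rewrite (expand_det_col _ 0) big1 1?eq_sym ?oner_eq0 //.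
  by move=> r _; have [->|/g0->] := eqVneq r 0; rewrite ?g00 mul0r.
(* The first column is now supported at the corner, so no other row can adjust the corner. In size 1
   the determinant settles the matter; otherwise adding the first row to the second creates a
   nonzero entry below the corner. *)
case: n IH P P1 PM PE g Pl P00 Pr dg h0 g0 g00 => [|n] IH P P1 PM PE g Pl P00 Pr dg h0 g0 g00.
  by apply: P00 => //; rewrite -det_mx11.
have h10 : (lift 0 0 : 'I_n.+2) != 0 by [].
apply: (Pl (lift 0 0) 0 1) => //; apply: (Pr _ (lift 0 0)) => //.
  by rewrite det_mulmx det_elem // mul1r.
by rewrite elem_mull eqxx !mul1r g0 // add0r.
Qed.

End Generation.

(** * Finite fields *)

Section FiniteField.
Variable k : finFieldType.

Lemma exists_nonroot (p : {poly k}) : p != 0 -> (size p <= #|k|)%N -> exists c, p.[c] != 0.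
Proof.
move=> p0 sp; apply: contrapT => hn; suff : (size (enum k) < size p)%N.
  by rewrite -cardE ltnNge sp.
apply: max_poly_roots => //; last exact: enum_uniq.
apply/allP => x _; apply/negPn/negP => hx; apply: hn; exists x; exact: hx.
Qed.

Lemma exists_sq_neq1 : (3 < #|k|)%N -> exists c : k, c != 0 /\ c ^+ 2 != 1.
Proof.
move=> hq; have [|| c] := @exists_nonroot ('X * ('X^2 - 1)).
- by rewrite mulf_neq0 ?polyX_eq0 // -size_poly_eq0 -polyC1 size_XnsubC.
- by rewrite mulrC size_mulX -?size_poly_eq0 -polyC1 size_XnsubC.
rewrite !hornerE mulf_eq0 negb_or subr_eq0 => /andP[c0 c1]; by exists c.
Qed.

Lemma exists_cube_neq1 : (4 < #|k|)%N -> exists c : k, c != 0 /\ c ^+ 3 != 1.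
Proof.
move=> hq; have [|| c] := @exists_nonroot ('X * ('X^3 - 1)).
- by rewrite mulf_neq0 ?polyX_eq0 // -size_poly_eq0 -polyC1 size_XnsubC.
- by rewrite mulrC size_mulX -?size_poly_eq0 -polyC1 size_XnsubC.
rewrite !hornerE mulf_eq0 negb_or subr_eq0 => /andP[c0 c1]; by exists c.
Qed.

Lemma char2_sqrt : 2 = 0 :> k -> forall x : k, exists y, x = y ^+ 2.
Proof.
move=> h2 x; have inj : injective (fun y : k => y ^+ 2).
  move=> a b /= /eqP; rewrite -subr_eq0 => /eqP hab.
  have : (a - b) ^+ 2 = 0.
    have -> : (a - b) ^+ 2 = a ^+ 2 - b ^+ 2 + 2 * b * (b - a) by ring.
    by rewrite hab h2 !mul0r addr0.
  by move/eqP; rewrite expf_eq0 /= subr_eq0 => /eqP.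
by exists (invF inj x); rewrite (f_invF inj).
Qed.

(** Coroots scale a root line by squares only; this lemma turns stability under squares into
    stability under k, for additive subgroups and additive maps alike. *)
Lemma sub_squares (x : k) : exists c d : k, x = c ^+ 2 - d ^+ 2.
Proof.
have [h2|h2] := eqVneq (2 : k) 0.
  by have [y ->] := char2_sqrt h2 x; exists y, 0; rewrite expr0n subr0.
exists ((x + 1) / 2), ((x - 1) / 2); by field.
Qed.

Definition additive_map (f : k -> k) := forall a b, f (a + b) = f a + f b.

Lemma additive0 f : additive_map f -> f 0 = 0.
Proof. by move=> fD; have /eqP := fD 0 0; rewrite addr0 -subr_eq subrr => /eqP. Qed.

Lemma additiveB f : additive_map f -> forall a b, f (a - b) = f a - f b.
Proof. by move=> fD a b; apply/eqP; rewrite eq_sym subr_eq -fD subrK. Qed.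

Lemma additive_square_linear f : additive_map f ->
  (forall c b, c != 0 -> f (c ^+ 2 * b) = c ^+ 2 * f b) -> forall b, f b = b * f 1.
Proof.
move=> fD fc b; have [c [d ->]] := sub_squares b.
have sq x : f (x ^+ 2) = x ^+ 2 * f 1.
  have [->|x0] := eqVneq x 0; first by rewrite expr0n /= additive0 // mul0r.
  by rewrite -[in LHS](mulr1 (x ^+ 2)) fc.
by rewrite additiveB // !sq mulrBl.
Qed.

(* In odd characteristic use (c+1)^2 + (c-1)^2 = 2c^2 + 2: the inverses satisfy the same relation only for the roots of a polynomial of degree 9. *)
Lemma additive_inv_square_eq0 f : (9 < #|k|)%N -> additive_map f ->
  (forall c b, c != 0 -> f (c ^+ 2 * b) = c ^- 2 * f b) -> forall b, f b = 0.
Proof.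
move=> hq fD fc b.
have [h2|h2] := eqVneq (2 : k) 0.
  (* In characteristic 2 every element is a square, so f(x b) = x^-1 f(b) for all nonzero x.
     Additivity at x + 1 then gives f(b) = 0 unless x^-1 + 1 = (x + 1)^-1, that is x^2 + x + 1 =
     0. *)
  have [||x] := @exists_nonroot ('X * ('X + 1) * ('X ^+2 + 'X + 1)).
  - rewrite !mulf_neq0 ?polyX_eq0 // -size_poly_eq0.
      by rewrite -polyC1 size_XaddC.
    by rewrite -addrA size_polyDl size_polyXn -?polyC1 ?size_XaddC.
  - have s2 : size ('X^2 + 'X + 1 : {poly k}) = 3%N.
      by rewrite -addrA size_polyDl size_polyXn -?polyC1 ?size_XaddC.
    have s1 : size ('X + 1 : {poly k}) = 2%N by rewrite -polyC1 size_XaddC.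
    apply: (leq_trans (size_polyMleq _ _)); rewrite s2.
    have := size_polyMleq ('X : {poly k}) ('X + 1); rewrite size_polyX s1; lia.
  rewrite !hornerE !mulf_eq0 !negb_or => /andP[/andP[x0 x1] x2].
  have [y ey] := char2_sqrt h2 x; have [z ez] := char2_sqrt h2 (x + 1).
  have y0 : y != 0 by move: x0; rewrite ey expf_eq0.
  have z0 : z != 0 by move: x1; rewrite ez expf_eq0.
  have := fc z b z0; rewrite -ez mulrDl mul1r fD ey fc // -ey.
  move/eqP; rewrite -subr_eq0 -[X in _ + X - _](mul1r (f b)) -mulrDl -mulrBl mulf_eq0.
  case/orP => [|/eqP//]; suff -> : x^-1 + 1 - (x + 1)^-1 = (x ^+ 2 + x + 1) / (x * (x + 1)).
    by rewrite mulf_eq0 (negPf x2) invr_eq0 mulf_eq0 (negPf x0) (negPf x1).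
  by field; rewrite x0 x1.
set p : {poly k} := 'X * ('X^2 - 1) * ('X^2 + 1) * (('X^2 - 1) ^+ 2 - 'X^2).
have sm : size ('X^2 - 1 : {poly k}) = 3%N by rewrite -polyC1 size_XnsubC.
have s2 : size (('X^2 - 1) ^+ 2 - 'X^2 : {poly k}) = 5%N.
  have s : size (('X^2 - 1) ^+ 2 : {poly k}) = 5%N.
    by rewrite expr2 size_mul -?size_poly_eq0 sm.
  by rewrite size_polyDl s // size_polyN size_polyXn.
have sp : size ('X^2 + 1 : {poly k}) = 3%N by rewrite -polyC1 size_XnaddC.
have [||c] := @exists_nonroot p.
- by rewrite !mulf_neq0 ?polyX_eq0 // -size_poly_eq0 ?s2 ?sm ?sp.
- apply: (leq_trans (size_polyMleq _ _)); rewrite s2.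
  have := size_polyMleq ('X * ('X^2 - 1) : {poly k}) ('X^2 + 1); rewrite sp.
  have := size_polyMleq ('X : {poly k}) ('X^2 - 1); rewrite sm size_polyX.
  move=> a1 a2; apply: leq_trans hq; move: (size _) a1 (size _) a2 => u /= ? v /= ?; lia.
rewrite /p !hornerE !mulf_eq0 !negb_or => /andP[/andP[/andP[c0 c1] c2] c3].
have e1 : c ^+ 2 - 1 = (c - 1) * (c + 1) by ring.
move: c1; rewrite e1 mulf_eq0 negb_or => /andP[cm cp].
have : f ((c + 1) ^+ 2 * b) + f ((c - 1) ^+ 2 * b) = f (c ^+ 2 * b) + f (c ^+ 2 * b) + (f b + f b).
  by rewrite -!fD; congr f; ring.
rewrite !fc // => /eqP; rewrite -subr_eq0.
suff -> : (c + 1) ^- 2 * f b + (c - 1) ^- 2 * f b - (c ^- 2 * f b + c ^- 2 * f b + (f b + f b)) =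
  - (2 * (c ^+ 2 + 1) * ((c ^+ 2 - 1) ^+ 2 - c ^+ 2) / (c * (c + 1) * (c - 1)) ^+ 2 * f b).
  rewrite oppr_eq0 !mulf_eq0 (negPf h2) (negPf c2) (negPf c3) invr_eq0 expf_eq0 /= !mulf_eq0.
  by rewrite (negPf c0) (negPf cp) (negPf cm) /= => /eqP.
by field; rewrite c0 cp cm.
Qed.

End FiniteField.

(** * Conjugation-stable subgroups of matrices *)

Section Torus.
Variables (k : fieldType) (n : nat).
Implicit Types (A B : 'M[k]_n) (i j l : 'I_n) (d : 'I_n -> k) (c : k).

Lemma is_scalarP A : reflect
  ((forall i j, i != j -> A i j = 0) /\ (forall i j, A i i = A j j)) (is_scalar_mx A).
Proof.
apply: (iffP is_scalar_mxP) => [[a ->]|[h0 hd]].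
  by split=> i j; [move=> /negPf hij; rewrite mxE hij | rewrite !mxE !eqxx].
case: (pickP 'I_n) => [i0 _|h]; last by exists 0; apply/matrixP => i; have := h i.
exists (A i0 i0); apply/matrixP=> i j; rewrite !mxE.
by have [<-|/h0->] := eqVneq i j; rewrite // (hd i i0) mulr1n.
Qed.

Definition torus d : 'M[k]_n := diag_mx (\row_i d i).

Lemma torus_mull d A r s : (torus d *m A) r s = d r * A r s.
Proof. by rewrite mul_diag_mx !mxE. Qed.

Lemma torus_mulr d A r s : (A *m torus d) r s = A r s * d s.
Proof. by rewrite mul_mx_diag !mxE. Qed.

Lemma det_torus d : \det (torus d) = \prod_i d i.
Proof. by rewrite det_diag; apply: eq_bigr => i _; rewrite mxE. Qed.

Lemma prod1_neq0 d : \prod_i d i = 1 -> forall i, d i != 0.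
Proof.
move=> hd i; apply/eqP => di; have /eqP := hd.
by rewrite (bigD1 i) //= di mul0r eq_sym oner_eq0.
Qed.

Lemma invmx_torus d : (forall i, d i != 0) -> invmx (torus d) = torus (fun i => (d i)^-1).
Proof.
move=> hd; apply: invmx_unique; apply/matrixP => r s; rewrite torus_mull !mxE.
by have [->|] := eqVneq r s; rewrite ?mulr0 // mulr1n divff.
Qed.

Lemma torus_elem d i j b : i != j -> (forall r, d r != 0) ->
  torus d *m elem i j b = elem i j (d i / d j * b) *m torus d.
Proof.
move=> hij d0; apply/matrixP => r s; rewrite torus_mull torus_mulr !mxE.
case: (eqVneq r i) => [->|_]; last first.
  by rewrite /= !mulr0 !addr0; case: (eqVneq r s) => [->|_]; rewrite /= ?mulr0 ?mul0r // mulrC.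
case: (eqVneq s j) => [->|_]; first by rewrite (negPf hij) /=; field; exact: d0.
by rewrite /= !mulr0 !addr0; case: (eqVneq i s) => [->|_]; rewrite /= ?mulr0 ?mul0r // mulrC.
Qed.

(** The cocharacter dual to the root (i, j), which takes the value c^2 on it. *)
Definition coroot i j c (r : 'I_n) : k := if r == i then c else if r == j then c^-1 else 1.

Lemma prod_coroot i j c : i != j -> c != 0 -> \prod_r coroot i j c r = 1.
Proof.
move=> hij c0; rewrite (bigD1 i) //= (bigD1 j) 1?eq_sym //= big1 /coroot.
  by rewrite eqxx eq_sym (negPf hij) eqxx mulr1 divff.
by move=> r /andP[/negPf-> /negPf->].
Qed.

(** This torus element commutes with the root subgroup (i, j), yet the roots (i, l) and (j, l) take
    the value c^3 on it; hence the need for an element whose cube is not 1. *)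
Definition coroot3 i j l c (r : 'I_n) : k :=
  if (r == i) || (r == j) then c else if r == l then c ^- 2 else 1.

Lemma prod_coroot3 i j l c : i != j -> l != i -> l != j -> c != 0 ->
  \prod_r coroot3 i j l c r = 1.
Proof.
move=> hij hli hlj c0; rewrite (bigD1 i) //= (bigD1 j) 1?eq_sym //= (bigD1 l) /=; last by rewrite hli.
rewrite big1 /coroot3 => [|r /andP[/andP[/negPf-> /negPf->] /negPf->] //].
by rewrite !eqxx orbT /= (negPf hli) (negPf hlj) /=; field.
Qed.

End Torus.

Section Submodule.
Variables (k : finFieldType) (n : nat) (M : 'M[k]_n -> Prop).
Hypotheses (hq : (3 < #|k|)%N) (M0 : M 0) (MB : forall A B, M A -> M B -> M (A - B)).
Hypothesis MJ : forall g A, \det g = 1 -> M A -> M (g *m A *m invmx g).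
Implicit Types (A B : 'M[k]_n) (i j l : 'I_n).

Let MN A : M A -> M (- A).
Proof. by move=> h; rewrite -sub0r; apply: MB. Qed.

Let MD A B : M A -> M B -> M (A + B).
Proof. by move=> hA /MN hB; rewrite -[B]opprK; apply: MB. Qed.

Let MJe A i j b : i != j -> M A -> M (elem i j b *m A *m elem i j (- b)).
Proof. by move=> hij hA; rewrite -invmx_elem //; apply: MJ => //; rewrite det_elem. Qed.

Let MJt A d : \prod_i d i = 1 -> M A -> M (torus d *m A *m torus (fun i => (d i)^-1)).
Proof.
move=> hd hA; rewrite -invmx_torus; last exact: prod1_neq0.
by apply: MJ => //; rewrite det_torus.
Qed.

Let line i j := forall b, M (b *: delta_mx i j).

(** Conjugation by coroots multiplies x by every square, and differences of squares exhaust k. *)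
Lemma line_of_one i j x : i != j -> x != 0 -> M (x *: delta_mx i j) -> line i j.
Proof.
move=> hij x0 hx b.
have sq c : M ((c ^+ 2 * x) *: delta_mx i j).
  have [->|c0] := eqVneq c 0; first by rewrite expr0n mul0r scale0r.
  have := MJt (prod_coroot hij c0) hx; congr M; apply/matrixP => r s.
  rewrite torus_mulr torus_mull !mxE /coroot.
  case: (eqVneq r i) => _; last by rewrite /= !(mulr0, mul0r).
  case: (eqVneq s j) => [->|_]; last by rewrite /= !(mulr0, mul0r).
  by rewrite eq_sym (negPf hij) invrK; ring.
have [c [d e]] := sub_squares (b / x).
have -> : b = c ^+ 2 * x - d ^+ 2 * x by rewrite -mulrBl -e divfK.
by rewrite scalerBl; apply: MB.
Qed.

Let subE A B r s : (A - B) r s = A r s - B r s.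
Proof. by rewrite !mxE. Qed.

Let addE A B r s : (A + B) r s = A r s + B r s.
Proof. by rewrite !mxE. Qed.

Ltac delta_cases := repeat match goal with |- context [nat_of_bool (?a == ?b)] =>
   case: (a == b) end; rewrite /=; try ring.

Lemma lineJ_row i j l : line i j -> i != j -> l != j -> line l j.
Proof.
move=> h hij hlj b; have [->|hli] := eqVneq l i; first exact: h.
suff -> : b *: delta_mx l j = elem l i 1 *m (b *: delta_mx i j) *m elem l i (- 1) - b *: delta_mx i j.
  exact: MB (MJe 1 hli (h b)) (h b).
apply/matrixP => r s; rewrite subE elem_conj !mxE eqxx.
rewrite [l == j](negPf hlj) -!mulnb !natrM /=; delta_cases.
Qed.

Lemma lineJ_col i j l : line i j -> i != j -> l != i -> line i l.
Proof.
move=> h hij hli b; have [->|hlj] := eqVneq l j; first exact: h.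
have hjl : j != l by rewrite eq_sym.
suff -> : b *: delta_mx i l = b *: delta_mx i j - elem j l 1 *m (b *: delta_mx i j) *m elem j l (- 1).
  exact: MB (h b) (MJe 1 hjl (h b)).
apply/matrixP => r s; rewrite subE elem_conj !mxE eqxx.
rewrite [l == i](negPf hli) -!mulnb !natrM /=; delta_cases.
Qed.

(** Conjugating b E_ij by 1 + t E_ji adds t b (E_jj - E_ii) - t^2 b E_ji. The pairs (t, b) = (1, c)
    and (c, 1) have the same diagonal part, so their difference is a multiple of E_ji alone. *)
Lemma line_opp i j : line i j -> i != j -> line j i.
Proof.
move=> h hij; have [c [c0 c1]] := exists_sq_neq1 hq.
have hji : j != i by rewrite eq_sym.
have cc : c ^+ 2 - c != 0.
  have -> : c ^+ 2 - c = c * (c - 1) by ring.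
  rewrite mulf_neq0 // subr_eq0; apply: contraNneq c1 => ->; by rewrite expr1n.
apply: (line_of_one hji cc).
suff -> : (c ^+ 2 - c) *: delta_mx j i =
   (elem j i 1 *m (c *: delta_mx i j) *m elem j i (- 1) - c *: delta_mx i j)
   - (elem j i c *m (1 *: delta_mx i j) *m elem j i (- c) - 1 *: delta_mx i j).
  exact: MB (MB (MJe 1 hji (h c)) (h c)) (MB (MJe c hji (h 1)) (h 1)).
apply/matrixP => r s; rewrite !subE !elem_conj !mxE !eqxx.
rewrite -!mulnb !natrM /=; delta_cases.
Qed.

Lemma line_all i j : line i j -> i != j -> forall a b, a != b -> line a b.
Proof.
move=> h hij a b hab; have [e|haj] := eqVneq a j.
  by rewrite {}e in hab *; apply: (@lineJ_col _ i); [exact: line_opp|rewrite eq_sym|rewrite eq_sym].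
by apply: (@lineJ_col _ j); [exact: lineJ_row h hij haj| |rewrite eq_sym].
Qed.

Lemma line_sl i j : line i j -> i != j -> forall B, \tr B = 0 -> M B.
Proof.
move=> h hij B tB; have hl := line_all h hij.
have hdiag a b x : a != b -> M (x *: delta_mx b b - x *: delta_mx a a).
  move=> hab; have hba : b != a by rewrite eq_sym.
  suff -> : x *: delta_mx b b - x *: delta_mx a a =
     elem b a 1 *m (x *: delta_mx a b) *m elem b a (- 1) - x *: delta_mx a b + x *: delta_mx b a.
    exact: MD (MB (MJe 1 hba (hl _ _ hab x)) (hl _ _ hab x)) (hl _ _ hba x).
  apply/matrixP => r s; rewrite [RHS]addE !subE elem_conj !mxE !eqxx.
  rewrite -!mulnb !natrM /=; delta_cases.
have hsum (I : finType) (F : I -> 'M[k]_n) : (forall u, M (F u)) -> M (\sum_u F u).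
  by move=> hF; apply: big_ind => // u v; apply: MD.
(* Each diagonal unit is paired with -E_ii for one fixed i; the total correction is (tr B) E_ii =
   0. *)
have -> : B = \sum_a \sum_b (B a b *: delta_mx a b - (B a b *+ (a == b)) *: delta_mx i i).
  have e a : \sum_b (B a b *: delta_mx a b - (B a b *+ (a == b)) *: delta_mx i i) =
      \sum_b B a b *: delta_mx a b - B a a *: delta_mx i i :> 'M[k]_n.
    rewrite sumrB; congr (_ - _); rewrite (bigD1 a) //= eqxx mulr1n big1 ?addr0 // => c /negPf hc.
    by rewrite eq_sym hc mulr0n scale0r.
  by rewrite (eq_bigr _ (fun a _ => e a)) sumrB -scaler_suml -/(mxtrace B) tB scale0r subr0 -matrix_sum_delta.
apply: (hsum _ (fun a => _)) => a; apply: (hsum _ (fun b => _)) => b.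
have [<-|hab] := eqVneq a b; last by rewrite mulr0n scale0r subr0; exact: hl.
have [->|hai] := eqVneq a i; first by rewrite subrr.
by apply: hdiag; rewrite eq_sym.
Qed.

Lemma sl_submodule A : M A -> ~~ is_scalar_mx A -> forall B, \tr B = 0 -> M B.
Proof.
move=> hA /is_scalarP nA.
suff [i [j [hij [x x0 hx]]]] : exists i j, i != j /\ exists2 x, x != 0 & M (x *: delta_mx i j).
  exact: line_sl (line_of_one hij x0 hx) hij.
have [c [c0 c1]] := exists_sq_neq1 hq.
case: (pickP (fun ij : 'I_n * 'I_n => (ij.1 != ij.2) && (A ij.2 ij.1 != 0))) => [[i j] /= /andP[hij aji]|hd].
  (* This quantity is the (i, j) entry gained by conjugating A with [elem i j b]. It vanishes at b =
     1 only if A_jj - A_ii = A_ji, and then b = c works because c is neither 0 nor 1. *)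
  have [b b0 hb] : exists2 b, b != 0 & b * (A j j - A i i) - b ^+ 2 * A j i != 0.
    have [e|e] := eqVneq ((A j j - A i i) - A j i) 0; last first.
      by exists 1; rewrite ?oner_neq0 // mul1r expr1n mul1r.
    exists c => //; have -> : A j j - A i i = A j i by apply/eqP; rewrite -subr_eq0 e.
    have -> : c * A j i - c ^+ 2 * A j i = c * (1 - c) * A j i by ring.
    rewrite !mulf_neq0 // subr_eq0 eq_sym; apply: contraNneq c1 => ->; by rewrite expr1n.
  pose B := elem i j b *m A *m elem i j (- b) - A.
  have MBB : M B by exact: MB (MJe b hij hA) hA.
  have eB r s : B r s = b * ((r == i)%:R * A j s) - b * (A r i * (s == j)%:R)
     - b ^+ 2 * ((r == i)%:R * (s == j)%:R) * A j i.
    by rewrite subE elem_conj; ring.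
  clearbody B.
  pose t := coroot i j c.
  (* C is supported off the diagonal on row i and column j, so one more elementary conjugation isolates a multiple of E_ij. *)
  pose C := torus t *m B *m torus (fun r => (t r)^-1) - B.
  have MC : M C by apply: MB => //; apply: MJt => //; exact: prod_coroot.
  have eC r s : C r s = (t r / t s - 1) * B r s.
    by rewrite /C subE torus_mulr torus_mull /=; ring.
  clearbody C.
  have ti : t i = c by rewrite /t /coroot eqxx.
  have tj : t j = c^-1 by rewrite /t /coroot eqxx eq_sym (negPf hij).
  have C0 r s : r != i -> s != j -> C r s = 0.
    by move=> /negPf hr /negPf hs; rewrite eC eB hr hs /=; ring.
  have Cd r : C r r = 0 by rewrite eC divff ?subrr ?mul0r //; exact: (prod1_neq0 (prod_coroot hij c0)).
  have Cij : C i j != 0.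
    rewrite eC eB !eqxx ti tj invrK !mul1r !mulr1 -mulrBr mulf_neq0 //.
    by rewrite subr_eq0 -expr2.
  case: (pickP (fun l => (l != i) && (l != j) && ((C i l != 0) || (C l j != 0)))) => [l|hl].
    case/andP=> /andP[hli hlj]; have [_|cil _] := eqVneq (C i l) 0; last first.
      exists i, j; split=> //; exists (C i l) => //.
      suff -> : C i l *: delta_mx i j = C - elem l j 1 *m C *m elem l j (- 1).
        exact: MB MC (MJe 1 hlj MC).
      have Cj s : C j s = 0.
        by have [->|hsj] := eqVneq s j; [exact: Cd|rewrite C0 // eq_sym].
      have Cl r : C r l = (r == i)%:R * C i l.
        by have [->|hri] := eqVneq r i; rewrite ?mul1r // mul0r C0.
      by apply/matrixP=> r s; rewrite subE elem_conj !mxE !Cj (Cl r) -mulnb natrM; ring.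
    move=> /= clj; exists i, j; split=> //; exists (C l j) => //.
    have hil : i != l by rewrite eq_sym.
    suff -> : C l j *: delta_mx i j = elem i l 1 *m C *m elem i l (- 1) - C.
      exact: MB (MJe 1 hil MC) MC.
    have Ci r : C r i = 0.
      by have [->|hri] := eqVneq r i; [exact: Cd|rewrite C0].
    have Cl s : C l s = (s == j)%:R * C l j.
      by have [->|hsj] := eqVneq s j; rewrite ?mul1r // mul0r C0.
    by apply/matrixP=> r s; rewrite subE elem_conj !mxE !Ci (Cl s) -mulnb natrM; ring.
  exists i, j; split=> //; exists (C i j) => //; suff -> : C i j *: delta_mx i j = C by [].
  apply/matrixP=> r s; rewrite !mxE.
  have hl' l : l != i -> l != j -> C i l = 0 /\ C l j = 0.
    move=> h1 h2; move: (hl l); rewrite h1 h2 /= => /negbT; rewrite negb_or !negbK.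
    by case/andP=> /eqP-> /eqP->.
  have [->|hri] := eqVneq r i; have [->|hsj] := eqVneq s j; rewrite ?mulr1 ?mulr0 //.
  - by have [->|hsi] := eqVneq s i; rewrite ?Cd // (hl' s hsi hsj).1.
  - by have [->|hrj] := eqVneq r j; rewrite ?Cd // (hl' r hri hrj).2.
  - by rewrite C0.
(* What remains is A diagonal and not scalar: conjugation by [elem i j 1] then adds exactly (A_jj -
   A_ii) E_ij. *)
have off r s : r != s -> A r s = 0.
  move=> hrs; move: (hd (s, r)); rewrite /= eq_sym hrs /= => /negbFE/eqP->//.
have [[i j] /= hij] : exists ij : 'I_n * 'I_n, A ij.1 ij.1 != A ij.2 ij.2.
  apply: contrapT => h; apply: nA; split=> // i j; apply/eqP/negPn/negP => hn.
  by apply: h; exists (i, j).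
have nij : i != j by apply: contraNneq hij => ->.
exists i, j; split=> //; exists (A j j - A i i); first by rewrite subr_eq0 eq_sym.
suff -> : (A j j - A i i) *: delta_mx i j = elem i j 1 *m A *m elem i j (- 1) - A.
  exact: MB (MJe 1 nij hA) hA.
have Ad r s : A r s = (r == s)%:R * A r r.
  by have [->|hrs] := eqVneq r s; rewrite ?mul1r // mul0r off.
apply/matrixP=> r s; rewrite subE elem_conj !mxE (off j i) 1?eq_sym // (Ad j s) (Ad r i) -mulnb natrM.
rewrite [j == s]eq_sym; case: (eqVneq r i) => [->|_]; rewrite /=; ring.
Qed.
End Submodule.

(** * Cocycles modulo scalars *)

Section ModScalars.
Variables (k : fieldType) (n : nat).
Implicit Types (A B C U V : 'M[k]_n).

Definition eqs A B : bool := is_scalar_mx (A - B).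

(** Off-diagonal entries and differences of diagonal entries are the coordinates that survive modulo
    scalars; all later comparisons are made through them. *)
Lemma eqsP A B : reflect
  ((forall i j, i != j -> A i j = B i j) /\ (forall i j, A i i - A j j = B i i - B j j)) (eqs A B).
Proof.
apply: (iffP (is_scalarP _)) => [[h0 hd]|[h0 hd]]; split=> i j => [hij|].
- by have := h0 _ _ hij; rewrite !mxE => /eqP; rewrite subr_eq0 => /eqP.
- have /eqP := hd i j; rewrite !mxE -subr_eq0 => /eqP h; apply/eqP; rewrite -subr_eq0 -h; apply/eqP; ring.
- by rewrite !mxE h0 // subrr.
- have /eqP := hd i j; rewrite !mxE -subr_eq0 => /eqP h; apply/eqP; rewrite -subr_eq0 -h; apply/eqP; ring.
Qed.

Lemma eqs_off A B i j : eqs A B -> i != j -> A i j = B i j.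
Proof. by case/eqsP => h _; apply: h. Qed.

Lemma eqs_diag A B i j : eqs A B -> A i i - A j j = B i i - B j j.
Proof. by case/eqsP => _ h; apply: h. Qed.

Lemma scalarD A B : is_scalar_mx A -> is_scalar_mx B -> is_scalar_mx (A + B).
Proof. by move=> /is_scalar_mxP[a ->] /is_scalar_mxP[b ->]; apply/(@is_scalar_mxP _ n); exists (a + b); rewrite raddfD. Qed.

Lemma scalarN A : is_scalar_mx A -> is_scalar_mx (- A).
Proof. by case/is_scalar_mxP=> a ->; apply/(@is_scalar_mxP _ n); exists (- a); rewrite raddfN. Qed.

Lemma scalarZ a A : is_scalar_mx A -> is_scalar_mx (a *: A).
Proof. by move=> /is_scalar_mxP[b ->]; apply/(@is_scalar_mxP _ n); exists (a * b); rewrite scale_scalar_mx. Qed.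

Lemma scalarJ U V A : U *m V = 1%:M -> is_scalar_mx A -> is_scalar_mx (U *m A *m V).
Proof.
move=> UV /is_scalar_mxP[a ->].
by rewrite scalar_mxC -mulmxA UV mulmx1 scalar_mx_is_scalar.
Qed.

Lemma eqs_refl A : eqs A A.
Proof. by rewrite /eqs subrr mx0_is_scalar. Qed.

Lemma eqs_sym A B : eqs A B -> eqs B A.
Proof. by move/scalarN; rewrite opprB. Qed.

Lemma eqs_trans B A C : eqs A B -> eqs B C -> eqs A C.
Proof. by move=> h1 /(scalarD h1); rewrite /eqs addrA subrK. Qed.

Lemma eqsD A B A' B' : eqs A A' -> eqs B B' -> eqs (A + B) (A' + B').
Proof.
move=> h1 /(scalarD h1); rewrite /eqs; congr (is_true (is_scalar_mx _)).
by rewrite opprD addrACA.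
Qed.

Lemma eqsN A A' : eqs A A' -> eqs (- A) (- A').
Proof. by move/scalarN; rewrite /eqs opprD. Qed.

Lemma eqsB A B A' B' : eqs A A' -> eqs B B' -> eqs (A - B) (A' - B').
Proof. by move=> h1 /eqsN; apply: eqsD. Qed.

Lemma eqsJ U V A B : U *m V = 1%:M -> eqs A B -> eqs (U *m A *m V) (U *m B *m V).
Proof. by move=> UV /(scalarJ UV); rewrite mulmxBr mulmxBl. Qed.

Lemma eqs0 A : eqs A 0 = is_scalar_mx A.
Proof. by rewrite /eqs subr0. Qed.

End ModScalars.

Lemma card_finField_eq0 (k : finFieldType) : (#|k|)%:R = 0 :> k.
Proof.
have [p pp hp] := finPcharP k.
have e : #|k| = (p ^ logn p #|pPrimeCharType hp|)%N := card_pprimeChar hp.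
have := finNzRing_gt1 k; rewrite e; case: (logn _ _) => // l _.
by rewrite natrX (pcharf0 hp) expr0n.
Qed.

Section Cocycle.
Variables (k : finFieldType) (m : nat).
Local Notation n := m.+1.
Variable G : 'M[k]_n -> Prop.
Hypothesis hq : (9 < #|k|)%N.
Hypotheses (GU : forall g, G g -> g \in unitmx) (GM : forall g h, G g -> G h -> G (g *m h)).
Hypothesis GS : forall g, \det g = 1 -> G g.
Implicit Types (A B g h : 'M[k]_n).

(** The right-handed convention comes from writing h = s(h) (1 + pi Z_h): in a product g h the
    factor 1 + pi Z_g must be moved to the right past s(h). *)
Definition cocycle (X : 'M[k]_n -> 'M[k]_n) := forall g h, G g -> G h ->
  eqs (X (g *m h)) (invmx h *m X g *m h + X h).

Definition cobound (Y g : 'M[k]_n) := Y - invmx g *m Y *m g.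

Lemma cocycleB X Y : cocycle X -> cocycle (fun g => X g - cobound Y g).
Proof.
move=> hX g h Gg Gh; have := hX g h Gg Gh; rewrite /eqs; congr (is_true (is_scalar_mx _)).
rewrite /cobound invmxM ?GU // mulmxBr mulmxBl mulmxBr mulmxBl !mulmxA.
have aux (a b c y z w : 'M[k]_n) : a - (b + c) = a - (y - z) - (b - (w - z) + (c - (y - w))).
  by apply/matrixP=> ? ?; rewrite !mxE; ring.
exact: aux.
Qed.

Lemma coboundD Y Y' g : cobound (Y + Y') g = cobound Y g + cobound Y' g.
Proof. by rewrite /cobound mulmxDr mulmxDl opprD addrACA. Qed.

Let dT (d : 'I_n -> k) : \prod_i d i = 1 -> G (torus d).
Proof. by move=> hd; apply: GS; rewrite det_torus. Qed.

(* The torus of diagonal matrices of determinant 1 has order prime to the characteristic, so averaging trivializes the cocycle on it. *)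
Lemma torus_average X : cocycle X ->
  exists Y, forall d : 'I_n -> k, \prod_i d i = 1 -> is_scalar_mx (X (torus d) - cobound Y (torus d)).
Proof.
move=> hX.
(* The determinant-1 torus is parametrized by m free nonzero coordinates, the last one being forced.
   Its order (|k| - 1)^m is a power of -1 in k, hence invertible. *)
pose ext (u : {ffun 'I_m -> k}) (i : 'I_m.+1) : k :=
  if unlift ord_max i is Some j then u j else (\prod_j u j)^-1.
have extl u (j : 'I_m) : ext u (lift ord_max j) = u j by rewrite /ext liftK.
have extm (u : {ffun 'I_m -> k}) : ext u ord_max = (\prod_j u j)^-1 by rewrite /ext unlift_none.
have liftE (j : 'I_m) : lift ord_max j = widen_ord (leqnSn m) j by apply: val_inj; rewrite /= /bump leqNgt ltn_ord.
pose U := [pred u : {ffun 'I_m -> k} | u \in ffun_on (predC1 0)].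
have UP (u : {ffun 'I_m -> k}) : reflect (forall j, u j != 0) (u \in U) by exact: ffun_onP.
have prodU (u : {ffun 'I_m -> k}) : u \in U -> \prod_j u j != 0.
  by move=> /UP hu; apply/prodf_neq0 => j _.
have pext (u : {ffun 'I_m -> k}) : u \in U -> \prod_i ext u i = 1.
  move=> hu; rewrite big_ord_recr /= extm (eq_bigr u) => [|j _].
    by rewrite divff // prodU.
  by rewrite -liftE extl.
have NU : (#|U|%:R : k) != 0.
  rewrite card_ffun_on natrX expf_eq0 negb_and; apply/orP; right.
  rewrite cardC1 -subn1 natrB; last by rewrite ltnW // finNzRing_gt1.
  by rewrite card_finField_eq0 sub0r oppr_eq0 oner_eq0.
pose S := \sum_(u in U) X (torus (ext u)).
exists (#|U|%:R^-1 *: S) => d hd.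
have d0 := prod1_neq0 hd.
pose u0 : {ffun 'I_m -> k} := [ffun j => d (lift ord_max j)].
have eu0 i : ext u0 i = d i.
  rewrite /ext; case: unliftP => [j ->|->]; first by rewrite ffunE.
  rewrite (eq_bigr (fun j => d (widen_ord (leqnSn m) j))) => [|j _]; last by rewrite ffunE liftE.
  have p0 : \prod_(j < m) d (widen_ord (leqnSn m) j) != 0 by apply/prodf_neq0 => j _; exact: d0.
  by apply: (mulfI p0); rewrite divff // -[LHS]hd big_ord_recr.
have et : torus (ext u0) = torus d.
  by apply/matrixP => r s; rewrite !mxE eu0.
have u0U : u0 \in U by apply/UP => j; rewrite ffunE.
set h := torus d; set T := invmx h.
have hT : T *m h = 1%:M by apply/mulVmx/GU/dT.
pose mulu (u v : {ffun 'I_m -> k}) : {ffun 'I_m -> k} := [ffun j => u j * v j].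
have tmul u : torus (ext (mulu u u0)) = torus (ext u) *m h.
  apply/matrixP => r s; rewrite torus_mulr !mxE; have [->|_] := eqVneq r s; last by rewrite !mulr0n mul0r.
  rewrite !mulr1n -eu0 /ext; case: unliftP => [j _|_]; first by rewrite ffunE.
  by rewrite -invfM -big_split /=; congr (_^-1); apply: eq_bigr => j _; rewrite ffunE.
have hS : eqs S (T *m S *m h + #|U|%:R *: X h).
  have eS : S = \sum_(u in U) X (torus (ext u) *m h).
    rewrite /S (reindex_onto (fun u => mulu u u0) (fun u => mulu u [ffun j => (u0 j)^-1])) /=.
      apply: eq_big => [u|u _]; last by rewrite tmul.
      have /UP u00 := u0U.
      have -> : mulu (mulu u u0) [ffun j => (u0 j)^-1] = u.
        by apply/ffunP => j; rewrite !ffunE mulfK //; have := u00 j; rewrite ffunE.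
      rewrite eqxx andbT; apply/UP/UP => hu j; have := hu j; rewrite !ffunE ?mulf_eq0 ?negb_or.
        by case/andP.
      by move=> ->; have := u00 j; rewrite ffunE.
    move=> u _; apply/ffunP => j; rewrite !ffunE divfK //; have /UP/(_ j) := u0U; by rewrite ffunE.
  rewrite {1}eS; have -> : T *m S *m h + #|U|%:R *: X h = \sum_(u in U) (T *m X (torus (ext u)) *m h + X h).
    by rewrite big_split /= sumr_const scaler_nat /S mulmx_sumr mulmx_suml.
  apply: (big_ind2 (fun A B : 'M[k]_n => is_true (eqs A B))); first exact: eqs_refl.
    by move=> A A' B B'; apply: eqsD.
  by move=> u hu; apply: hX; apply: dT => //; apply: pext.
move/(scalarZ (- #|U|%:R^-1)): hS; congr (is_true (is_scalar_mx _)).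
rewrite scaleNr scalerBr opprB scalerDr scalerA mulVf // scale1r /cobound.
by rewrite -scalemxAr -scalemxAl opprB [_ + X h]addrC addrA.
Qed.

(** * Cocycles that are trivial on the diagonal torus *)

Section TorusTrivial.
Variable X : 'M[k]_n -> 'M[k]_n.
Hypothesis hX : cocycle X.
Hypothesis XT : forall d : 'I_n -> k, \prod_i d i = 1 -> is_scalar_mx (X (torus d)).

Let Xtl (d : 'I_n -> k) g : \prod_i d i = 1 -> G g -> eqs (X (torus d *m g)) (X g).
Proof.
move=> hd Gg; apply: eqs_trans (hX (dT hd) Gg) _.
rewrite /eqs addrK; apply: scalarJ; [exact/mulVmx/GU | exact: XT].
Qed.

Let Xtr (d : 'I_n -> k) g : \prod_i d i = 1 -> G g ->
  eqs (X (g *m torus d)) (invmx (torus d) *m X g *m torus d).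
Proof.
move=> hd Gg; apply: eqs_trans (hX Gg (dT hd)) _.
by rewrite /eqs [_ + X _]addrC addrK XT.
Qed.

Let Ge (i j : 'I_n) b : i != j -> G (elem i j b).
Proof. by move=> hij; apply: GS; rewrite det_elem. Qed.

Let entryJ (d : 'I_n -> k) A (r s : 'I_n) : \prod_i d i = 1 ->
  (invmx (torus d) *m A *m torus d) r s = (d r)^-1 * A r s * d s.
Proof. by move=> hd; rewrite invmx_torus ?torus_mulr ?torus_mull //; apply: prod1_neq0. Qed.

(** Evaluate X on both sides of t e(b) = e(a b) t with a = d_i / d_j. Since X is trivial on the
    torus, a torus factor on the left disappears and one on the right acts by conjugation. Every
    entry of X(e(b)) thus acquires a torus weight. *)
Lemma cocycle_elem_torus (d : 'I_n -> k) (i j : 'I_n) b : i != j -> \prod_i d i = 1 ->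
  eqs (X (elem i j b)) (invmx (torus d) *m X (elem i j (d i / d j * b)) *m torus d).
Proof.
move=> hij hd; have d0 := prod1_neq0 hd.
apply: eqs_trans (eqs_sym (Xtl hd (Ge b hij))) _.
by rewrite torus_elem //; apply: Xtr (Ge _ hij).
Qed.

Lemma cocycle_elem_off (d : 'I_n -> k) (i j r s : 'I_n) b : i != j -> r != s -> \prod_i d i = 1 ->
  X (elem i j (d i / d j * b)) r s = d r / d s * X (elem i j b) r s.
Proof.
move=> hij hrs hd; have d0 := prod1_neq0 hd.
rewrite (eqs_off (cocycle_elem_torus b hij hd) hrs) entryJ //; field.
by rewrite !d0.
Qed.

Lemma cocycle_elem_diag (d : 'I_n -> k) (i j r s : 'I_n) b : i != j -> \prod_i d i = 1 ->
  X (elem i j (d i / d j * b)) r r - X (elem i j (d i / d j * b)) s s =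
  X (elem i j b) r r - X (elem i j b) s s.
Proof.
move=> hij hd; have d0 := prod1_neq0 hd.
rewrite (eqs_diag r s (cocycle_elem_torus b hij hd)) !entryJ //; field.
by rewrite !d0.
Qed.

(** Some torus element is trivial on the root (i, j) but not on (r, s): a [coroot3] if the two roots
    share one index, a coroot of (r, s) if they are disjoint. The weight relation then multiplies
    the entry by a factor different from 1 without changing it. *)
Lemma cocycle_elem_support (i j r s : 'I_n) b : i != j -> r != s ->
  ~~ ((r == i) && (s == j)) -> ~~ ((r == j) && (s == i)) -> X (elem i j b) r s = 0.
Proof.
move=> hij hrs h1 h2.
have [d [hd dij drs]] : exists d : 'I_n -> k, [/\ \prod_i d i = 1, d i = d j & d r != d s].
  have [c [c0 c2]] := exists_sq_neq1 (leq_trans (isT : 4 <= 10)%N hq).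
  have [e [e0 e3]] := exists_cube_neq1 (leq_trans (isT : 5 <= 10)%N hq).
  have [hri|hri] := boolP ((r == i) || (r == j)).
    have [hsi hsj] : s != i /\ s != j.
      case/orP: hri h1 h2 hrs => /eqP ->; rewrite ?eqxx ?(negPf hij) ?[j == i]eq_sym ?(negPf hij) /=;
      by rewrite ?[i == s]eq_sym ?[j == s]eq_sym.
    exists (coroot3 i j s e); split; first exact: prod_coroot3.
      by rewrite /coroot3 !eqxx orbT.
    rewrite /coroot3 hri (negPf hsi) (negPf hsj) eqxx /=; apply: contraNneq e3 => he.
    by rewrite exprS {1}he mulVf // expf_neq0.
  case/norP: hri => hri hrj.
  have [hsi|hsi] := boolP ((s == i) || (s == j)).
    exists (coroot3 i j r e); split; first exact: prod_coroot3.
      by rewrite /coroot3 !eqxx orbT.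
    rewrite /coroot3 hsi (negPf hri) (negPf hrj) eqxx /=; apply: contraNneq e3 => he.
    by rewrite exprS -{1}he mulVf // expf_neq0.
  case/norP: hsi => hsi hsj; exists (coroot r s c); split; first exact: prod_coroot.
    by rewrite /coroot ![_ == r]eq_sym ![_ == s]eq_sym (negPf hri) (negPf hrj) (negPf hsi) (negPf hsj).
  rewrite /coroot eqxx [s == r]eq_sym (negPf hrs) eqxx; apply: contraNneq c2 => hc.
  by rewrite expr2 {1}hc mulVf.
have d0 := prod1_neq0 hd.
have /eqP := cocycle_elem_off b hij hrs hd.
rewrite dij divff // mul1r -subr_eq0 -{1}[X _ r s]mul1r -mulrBl mulf_eq0 subr_eq0.
case/orP => [|/eqP//]; rewrite eq_sym => /eqP/divr1_eq/eqP; by rewrite (negPf drs).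
Qed.

Lemma cocycle_elemD (i j : 'I_n) a b : i != j ->
  eqs (X (elem i j (a + b))) (elem i j (- b) *m X (elem i j a) *m elem i j (- - b) + X (elem i j b)).
Proof.
move=> hij; rewrite -elemD // opprK -(invmx_elem b hij).
exact: hX (Ge _ hij) (Ge _ hij).
Qed.

Let coroot_ratio (i j : 'I_n) (c : k) : i != j -> c != 0 ->
  (coroot i j c i / coroot i j c j = c ^+ 2) * (coroot i j c j / coroot i j c i = c ^- 2).
Proof.
move=> hij c0; rewrite /coroot !eqxx [j == i]eq_sym (negPf hij) invrK expr2; split=> //.
by rewrite invfM.
Qed.

Definition slope (i j : 'I_n) := X (elem i j 1) i j.

(** Only the weights opposite, zero and equal to (i, j) are left, and they are treated in this order
    because additivity of each entry in b relies on the preceding ones. The opposite weight is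
    excluded by [additive_inv_square_eq0], where the full bound on |k| enters; equal weight gives
    linearity in b. *)
Lemma cocycle_elem (i j : 'I_n) b : i != j ->
  eqs (X (elem i j b)) ((b * slope i j) *: delta_mx i j).
Proof.
move=> hij; have hji : j != i by rewrite eq_sym.
have gamma0 c : X (elem i j c) j i = 0.
  apply: (additive_inv_square_eq0 (f := fun c => X (elem i j c) j i) hq) => [a b'|a b' a0].
    rewrite (eqs_off (cocycle_elemD a b' hij)) // mxE elem_conj (negPf hji) (negPf hij) /=; ring.
  have := cocycle_elem_off b' hij hji (prod_coroot hij a0).
  by rewrite !(coroot_ratio hij a0).
have diag0 c r s : X (elem i j c) r r - X (elem i j c) s s = 0.
  pose f c := X (elem i j c) r r - X (elem i j c) s s; rewrite -/(f c).
  have fD : additive_map f.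
    move=> a b'; rewrite /f (eqs_diag r s (cocycle_elemD a b' hij)) ![(_ + X _) _ _]mxE !elem_conj !gamma0.
    have h (t : 'I_n) : ((t == i)%:R * X (elem i j a) j t = 0) * (X (elem i j a) t i * (t == j)%:R = 0).
      by split; case: eqP => [->|_]; rewrite ?gamma0 ?mulr0 ?mul0r.
    by rewrite !h; ring.
  have [e [e0 e2]] := exists_sq_neq1 (leq_trans (isT : 4 <= 10)%N hq).
  have e21 : e ^+ 2 - 1 != 0 by rewrite subr_eq0.
  (* An additive function invariant under multiplication by e^2 kills (e^2 - 1) x for all x, hence
     everything. *)
  have -> : c = e ^+ 2 * (c / (e ^+ 2 - 1)) - c / (e ^+ 2 - 1) by field.
  rewrite additiveB //; apply/eqP; rewrite subr_eq0; apply/eqP.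
  by have := cocycle_elem_diag r s (c / (e ^+ 2 - 1)) hij (prod_coroot hij e0); rewrite coroot_ratio.
have lin c : X (elem i j c) i j = c * slope i j.
  apply: (additive_square_linear (f := fun c => X (elem i j c) i j)) => [a b'|a b' a0].
    rewrite (eqs_off (cocycle_elemD a b' hij)) // mxE elem_conj !eqxx gamma0.
    have /eqP := diag0 a i j; rewrite subr_eq0 => /eqP ->; ring.
  have := cocycle_elem_off b' hij hij (prod_coroot hij a0).
  by rewrite !(coroot_ratio hij a0).
apply/eqsP; split=> r s => [hrs|].
  rewrite !mxE; case: (boolP ((r == i) && (s == j))) => [/andP[/eqP-> /eqP->]|h1].
    by rewrite lin mulr1.
  rewrite mulr0; case: (boolP ((r == j) && (s == i))) => [/andP[/eqP-> /eqP->]|h2]; first exact: gamma0.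
  exact: cocycle_elem_support.
rewrite diag0 !mxE; case: (eqVneq r i) => [->|_]; case: (eqVneq s i) => [->|_];
  by rewrite ?(negPf hij) /= ?mulr0 ?subrr.
Qed.

Let cocycle_elem_entries (i j : 'I_n) b : i != j ->
  [/\ X (elem i j b) i j = b * slope i j, X (elem i j b) j i = 0 &
      forall r s, X (elem i j b) r r = X (elem i j b) s s].
Proof.
move=> hij; have h := cocycle_elem b hij; split=> [||r s].
- by rewrite (eqs_off h hij) !mxE !eqxx mulr1.
- by rewrite (eqs_off h) 1?eq_sym // !mxE [j == i]eq_sym (negPf hij) mulr0.
- apply/eqP; rewrite -subr_eq0 (eqs_diag r s h) !mxE.
  by case: (eqVneq r i) => [->|_]; case: (eqVneq s i) => [->|_]; rewrite ?(negPf hij) /= ?mulr0 subrr.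
Qed.

Let elem_conjN A (i j : 'I_n) b r s : (elem i j (- b) *m A *m elem i j b) r s =
  A r s - b * ((r == i)%:R * A j s) + b * (A r i * (s == j)%:R)
  - b ^+ 2 * ((r == i)%:R * (s == j)%:R) * A j i.
Proof. by rewrite -{2}[b]opprK elem_conj; ring. Qed.

Let mxB A B (r s : 'I_n) : (A - B) r s = A r s - B r s.
Proof. by rewrite !mxE. Qed.

Let mxD A B (r s : 'I_n) : (A + B) r s = A r s + B r s.
Proof. by rewrite mxE. Qed.

(* Both sides of e_ij(c) e_ji(1) = e_ji(1/(1+c)) diag(1+c, 1/(1+c)) e_ij(c/(1+c)) are expanded by the cocycle rule and compared at the entry (j, i). *)
Lemma slope_opp (i j : 'I_n) : i != j -> slope i j + slope j i = 0.
Proof.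
move=> hij; have hji : j != i by rewrite eq_sym.
have [c [c0 c2]] := exists_sq_neq1 (leq_trans (isT : 4 <= 10)%N hq).
have u0 : 1 + c != 0.
  have e : c ^+ 2 = (1 + c) * (c - 1) + 1 by ring.
  by apply: contraNneq c2 => h; rewrite e h mul0r add0r.
set d := coroot i j (1 + c); have hd : \prod_r d r = 1 by exact: prod_coroot.
have di : d i = 1 + c by rewrite /d /coroot eqxx.
have dj : d j = (1 + c)^-1 by rewrite /d /coroot eqxx (negPf hji).
have rel : elem i j c *m elem j i 1 = elem j i (1 + c)^-1 *m torus d *m elem i j (c / (1 + c)).
  apply/matrixP=> r s; rewrite !elem_mulr !torus_mulr !mxE di.
  have [->|hri] := eqVneq r i; have [->|hsi] := eqVneq s i;
    rewrite ?eqxx ?(negPf hij) ?(negPf hji) ?(negPf hri) ?(negPf hsi) ?di ?dj /=; try by field.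
  - by case: (r == j); rewrite /=; field.
  - have [hrj|hrj] := eqVneq r j; have [hsj|hsj] := eqVneq s j; rewrite ?hrj ?hsj ?eqxx ?dj /=.
    + by field.
    + by rewrite [j == s]eq_sym (negPf hsj) /=; ring.
    + by rewrite (negPf hrj) /=; ring.
    + have -> : d s = 1 by rewrite /d /coroot (negPf hsi) (negPf hsj).
      by ring.
have [e1 e2 e3] := cocycle_elem_entries c hij.
have [f1 _ _] := cocycle_elem_entries 1 hji.
have [f'1 _ _] := cocycle_elem_entries (1 + c)^-1 hji.
have [_ e'2 _] := cocycle_elem_entries (c / (1 + c)) hij.
have L := eqs_off (hX (Ge c hij) (Ge 1 hji)) hji.
rewrite rel invmx_elem // mxD f1 elem_conjN !eqxx e1 e2 (e3 j i) in L.
have Gft := GM (Ge (1 + c)^-1 hji) (dT hd).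
have Rr := eqs_off (hX Gft (Ge (c / (1 + c)) hij)) hji.
rewrite invmx_elem // mxD e'2 elem_conjN (negPf hij) (negPf hji) in Rr.
rewrite (eqs_off (Xtr hd (Ge _ hji)) hji) entryJ // f'1 di dj L in Rr.
apply: (mulfI c0); rewrite mulr0.
move/eqP: Rr; rewrite -subr_eq0 => /eqP Rr; apply/eqP; rewrite -oppr_eq0 -{}Rr; apply/eqP.
by rewrite /= !mul0r !mulr0; field; rewrite u0 oner_neq0.
Qed.

(** The commutator relation between the root subgroups (i, j) and (j, l) is expanded by the cocycle
    rule and compared at the entry (i, l). *)
Lemma slope_add (i j l : 'I_n) : i != j -> j != l -> i != l ->
  slope i l = slope i j + slope j l.
Proof.
move=> hij hjl hil; have hji : j != i by rewrite eq_sym.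
have hlj : l != j by rewrite eq_sym.
have hli : l != i by rewrite eq_sym.
have rel : elem i j 1 *m elem j l 1 = elem i l 1 *m elem j l 1 *m elem i j 1 :> 'M[k]_n.
  apply/matrixP=> r s; rewrite !elem_mulr !mxE.
  rewrite ?eqxx ?(negPf hji) ?(negPf hij) ?(negPf hil) ?(negPf hli) ?(negPf hjl) ?(negPf hlj).
  by rewrite ?andbT ?andbF -?mulnb ?natrM /=; ring.
have off (a b r s : 'I_n) (x : k) : a != b -> r != s -> X (elem a b x) r s = (x * slope a b) * ((r == a) && (s == b))%:R.
  by move=> hab hrs; rewrite (eqs_off (cocycle_elem x hab)) // !mxE.
have L := eqs_off (hX (Ge 1 hij) (Ge 1 hjl)) hil.
rewrite rel invmx_elem // mxD elem_conjN (negPf hij) eqxx /= !mul0r !mulr0 mul0r !mulr1 !off // in L.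
have Gft := GM (Ge 1 hil) (Ge 1 hjl).
have Q r s (hrs : r != s) := eqs_off (hX (Ge 1 hil) (Ge 1 hjl)) hrs.
have Rr := eqs_off (hX Gft (Ge 1 hij)) hil.
rewrite invmx_elem // mxD elem_conjN eqxx (negPf hlj) /= !mulr0 mul0r !Q // in Rr.
rewrite invmx_elem // !mxD !elem_conjN in Rr.
have [_ _ dd] := cocycle_elem_entries 1 hil.
rewrite L (dd j l) ?eqxx ?(negPf hij) !mul0r (off i l i l) // (off i l i j) // (off i l l j) // (off j l i l) // (off i l j l) // (off j l j l) // (off i j i l) // ?eqxx ?(negPf hij) ?(negPf hlj) ?(negPf hji) ?(negPf hjl) ?(negPf hli) in Rr.
move: Rr => /eqP; rewrite -subr_eq0 => /eqP Rr; apply/eqP; rewrite -subr_eq0 -oppr_eq0 -Rr; apply/eqP.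
by rewrite /=; ring.
Qed.

(** Invariance modulo scalars under a coroot kills the off-diagonal entries; invariance under
    [elem i j 1], read at (i, j), then equates the diagonal ones. *)
Lemma eqs_conj_torus_elem_scalar A :
  (forall s, \det s = 1 -> eqs (invmx s *m A *m s) A) -> is_scalar_mx A.
Proof.
move=> hA; have [c [c0 c2]] := exists_sq_neq1 (leq_trans (isT : 4 <= 10)%N hq).
have off (r s : 'I_n) : r != s -> A r s = 0.
  move=> hrs; have hd := prod_coroot hrs c0.
  have := eqs_off (hA _ (etrans (det_torus _) hd)) hrs.
  rewrite entryJ // /coroot !eqxx [s == r]eq_sym (negPf hrs) => /eqP.
  rewrite -subr_eq0 (_ : _ - _ = (c ^- 2 - 1) * A r s); last by field.
  rewrite mulf_eq0 subr_eq0 => /orP[|/eqP//].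
  by rewrite invr_eq1 (negPf c2).
apply/is_scalarP; split=> // i j; have [->//|hij] := eqVneq i j.
have := eqs_off (hA _ (det_elem 1 hij)) hij.
rewrite invmx_elem // elem_conjN !eqxx (off j i) 1?eq_sym // => /eqP.
rewrite -subr_eq0 (_ : _ - _ = A i i - A j j); last by rewrite /=; ring.
by rewrite subr_eq0 => /eqP.
Qed.

(** By [slope_opp] and [slope_add] the slopes are differences y_j - y_i, which are also the slopes
    of the coboundary of the diagonal matrix with entries y. Here [torus y] is only a diagonal
    matrix, not an element of the torus. Subtracting it trivializes X on all root subgroups, hence
    on SL_n(k). *)
Lemma cocycle_trivial_of_torus : exists Y, forall g, G g -> is_scalar_mx (X g - cobound Y g).
Proof.
pose y (i : 'I_n) := if i == 0 then 0 else slope 0 i.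
exists (torus y); set X' := fun g => X g - cobound (torus y) g.
have hX' : cocycle X' := cocycleB _ hX.
have scM g h : G g -> G h -> is_scalar_mx (X' g) -> is_scalar_mx (X' h) -> is_scalar_mx (X' (g *m h)).
  move=> Gg Gh sg sh; rewrite -eqs0; apply: eqs_trans (hX' _ _ Gg Gh) _; rewrite eqs0.
  by apply: scalarD => //; apply: scalarJ sg; apply/mulVmx/GU.
have y_slope i j : i != j -> y j - y i = slope i j.
  move=> hij; rewrite /y; have [i0|hi] := eqVneq i 0; have [j0|hj] := eqVneq j 0.
  - by rewrite i0 j0 eqxx in hij.
  - by rewrite subr0 i0.
  - by apply/eqP; rewrite sub0r eq_sym -subr_eq0 opprK j0 slope_opp // -j0.
  - have h0i : 0 != i by rewrite eq_sym.
    have h0j : 0 != j by rewrite eq_sym.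
    by rewrite (slope_add h0i hij h0j) addrC addKr.
have scS g : \det g = 1 -> is_scalar_mx (X' g).
  move=> dg; suff [] : G g /\ is_scalar_mx (X' g) by [].
  apply: (sl_generated (P := fun g => G g /\ is_scalar_mx (X' g))) dg.
  - have d1 : \prod_(i < n) (1 : k) = 1 by rewrite big1.
    have e0 : 1%:M = torus (fun _ : 'I_n => 1 : k) by apply/matrixP=> r s; rewrite !mxE.
    split; first by rewrite e0; exact: dT.
    rewrite /X' /cobound (invmx_unique (mulmx1 _)) mulmx1 mul1mx subrr subr0 e0; exact: XT.
  - by move=> A B [GA sA] [GB sB]; split; [apply: GM|apply: scM].
  - move=> i j b hij; split; first exact: Ge.
    rewrite -eqs0; apply: eqs_trans (eqsB (cocycle_elem b hij) (eqs_refl _)) _.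
    suff -> : (b * slope i j) *: delta_mx i j - cobound (torus y) (elem i j b) = 0 by exact: eqs_refl.
    have YE r s : torus y r s = y r * (r == s)%:R by rewrite !mxE mulr_natr.
    apply/matrixP=> r s; rewrite /cobound invmx_elem // -(y_slope i j hij).
    move: (elem_conjN (torus y) i j b r s); set E := _ *m _ *m _ => eE.
    rewrite !mxB {}eE !YE !mxE [j == i]eq_sym (negPf hij) [j == s]eq_sym -mulnb natrM.
    case: (eqVneq r i) => [->|_]; last by rewrite /=; ring.
    by case: (eqVneq s j) => [->|_]; rewrite /= ?eqxx; ring.
(* To pass from SL_n(k) to G, expand X' on g s = (g s g^-1) g in both ways: X'(g) is fixed by
   SL_n(k) modulo scalars, so it is scalar. *)
move=> g Gg; apply: eqs_conj_torus_elem_scalar => s ds.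
have Gs := GS ds; have uG := GU Gg; have us := GU Gs.
have dgs : \det (g *m s *m invmx g) = 1.
  by rewrite !det_mulmx det_inv ds mulr1 divrr // -unitmxE.
have e : g *m s = g *m s *m invmx g *m g by rewrite mulmxKV.
apply: eqs_trans (eqs_trans (eqs_sym _) (hX' _ _ (GS dgs) Gg)) _; last first.
  by rewrite /eqs addrK; apply: scalarJ (scS _ dgs); apply: mulVmx.
rewrite -e; apply: eqs_trans (hX' _ _ Gg Gs) _.
by rewrite /eqs [_ + X' s]addrC addrK scS.
Qed.

End TorusTrivial.

Lemma cocycle_trivial X : cocycle X ->
  exists Y, forall g, G g -> is_scalar_mx (X g - cobound Y g).
Proof.
move=> hX; have [Y hY] := torus_average hX.
have [Y' hY'] := cocycle_trivial_of_torus (cocycleB Y hX) hY.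
by exists (Y + Y') => g Gg; rewrite coboundD opprD addrA; apply: hY'.
Qed.

End Cocycle.

(** * The residue field *)

Section ResidueField.
Import generic_quotient ring_quotient.
Local Open Scope quotient_scope.
Variables (R : idomainType) (pi : R) (c : nat).

Lemma inPow1_or_unit x : is_dvr pi -> inPow pi 1 x \/ x \is a GRing.unit.
Proof.
move=> [_ _ hx]; have [->|/hx[u [[|m] [uu ->]]]] := eqVneq x 0.
- by left; exists 0; rewrite mulr0.
- by right; rewrite expr0 mulr1.
- by left; exists (u * pi ^+ m); rewrite expr1 exprS mulrCA.
Qed.

Lemma inPowB m x y : inPow pi m x -> inPow pi m y -> inPow pi m (x - y).
Proof. by move=> [a ->] [b ->]; exists (a - b); rewrite mulrBr. Qed.

Lemma inPowD m x y : inPow pi m x -> inPow pi m y -> inPow pi m (x + y).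
Proof. by move=> [a ->] [b ->]; exists (a + b); rewrite mulrDr. Qed.

Lemma inPowM m x y : inPow pi m x -> inPow pi m (y * x).
Proof. by move=> [a ->]; exists (y * a); rewrite mulrCA. Qed.

Lemma inPow0 m : inPow pi m 0.
Proof. by exists 0; rewrite mulr0. Qed.

Lemma inPow1_1 : is_dvr pi -> ~ inPow pi 1 1.
Proof.
case=> [_ /negP npi _] [y e]; apply: npi; apply/unitrPr; exists y.
by rewrite e expr1.
Qed.

(** The list of representatives meets each class once, so it gives a bijection of the quotient with
    an ordinal, which supplies the finite structure. Inverses come from representatives, which are
    units outside the maximal ideal. *)
Lemma residue_field : is_dvr pi -> residue_finite_card_gt pi c ->
  exists (k : finFieldType) (red : {rmorphism R -> k}),
    [/\ forall a, exists x, red x = a, forall x, red x = 0 <-> inPow pi 1 x & (c < #|k|)%N].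
Proof.
move=> hdvr [s [s_inj s_surj s_card]].
pose I0 : R -> bool := fun x => `[< inPow pi 1 x >].
have I0_closed : idealr_closed (I0 : {pred R}).
  split; first exact/asboolP/inPow0.
    by apply/asboolP/inPow1_1.
  by move=> a u v /asboolP hu /asboolP hv; apply/asboolP; apply: inPowD => //; apply: inPowM.
pose I : idealr R := HB.pack I0 (isIdealr.Build R I0 I0_closed).
pose Q := {ideal_quot I}.
pose red : R -> Q := \pi_Q.
have redE x y : red x = red y <-> inPow pi 1 (x - y).
  split=> [/eqP|h].
    by rewrite -Quotient.idealrBE => /asboolP.
  by apply/eqP; rewrite -Quotient.idealrBE; apply/asboolP.
have red0 x : red x = 0 <-> inPow pi 1 x.
  rewrite -(rmorph0 \pi_Q) -/red; apply: (iff_trans (redE x 0)); by rewrite subr0.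
pose qinv (a : Q) : Q := if a == 0 then 0 else red (repr a)^-1.
have qmulV a : a != 0 -> qinv a * a = 1.
  rewrite /qinv => a0; rewrite (negPf a0) -[in X in _ * X](reprK a) -rmorphM mulVr ?rmorph1 //.
  case: (inPow1_or_unit (repr a) hdvr) => // /red0; rewrite /red reprK => e.
  by rewrite e eqxx in a0.
have qinv0 : qinv 0 = 0 by rewrite /qinv eqxx.
pose F : fieldType := HB.pack Q (GRing.ComNzRing_isField.Build Q qmulV qinv0).
have s_ex (a : Q) : exists i : 'I_(size s), red (s`_i) = a.
  have [y ys hy] := s_surj (repr a).
  exists (Ordinal (etrans (index_mem y s) ys)); rewrite /= nth_index //.
  by rewrite -[RHS]reprK; apply/esym/redE.
pose f (a : Q) : 'I_(size s) := projT1 (cid (s_ex a)).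
pose g (i : 'I_(size s)) : Q := red (s`_i).
have fK : cancel f g by move=> a; rewrite /f /g; case: (cid _).
have gK : cancel g f.
  move=> i; rewrite /f; case: (cid _) => j /= /redE hj; exact/val_inj/(s_inj _ _ _ _ hj).
pose C := CanIsCountable fK.
pose T : countType := HB.pack_for countType Q C.
have fKT : cancel (f : T -> 'I_(size s)) g := fK.
pose k : finFieldType := HB.pack_for finFieldType Q F C (CanIsFinite fKT).
pose r : {rmorphism R -> Q} := \pi_Q.
pose r' : {rmorphism R -> k} := r.
exists k, r'; split.
- by move=> a; exists (repr (a : Q)); exact: reprK.
- exact: red0.
- have fb : bijective (f : k -> 'I_(size s)) := Bijective fK gK.
  by rewrite (bij_eq_card fb) card_ord.
Qed.
End ResidueField.

(** * Determinants to first order *)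

Lemma prod_1D (R : comNzRingType) (I : Type) (s : seq I) (F : I -> R) (t : R) :
  exists r, \prod_(i <- s) (1 + t * F i) = 1 + t * (\sum_(i <- s) F i) + t ^+ 2 * r.
Proof.
elim: s => [|i s [r e]]; first by exists 0; rewrite !big_nil !mulr0 !addr0.
exists (F i * (\sum_(i <- s) F i) + r + t * F i * r).
rewrite !big_cons e; ring.
Qed.

(** In the Leibniz formula a permutation other than the identity moves some i and also s(i), so its
    term contains two off-diagonal factors and is divisible by t^2. *)
Lemma det_1D (R : comNzRingType) (n : nat) (Z : 'M[R]_n) (t : R) :
  exists r, \det (1%:M + t *: Z) = 1 + t * \tr Z + t ^+ 2 * r.
Proof.
rewrite /determinant (bigD1 1%g) //= odd_perm1 expr0 mul1r.
have -> : \prod_i (1%:M + t *: Z) i ((1%g : {perm 'I_n}) i) = \prod_i (1 + t * Z i i).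
  by apply: eq_bigr => i _; rewrite perm1 !mxE eqxx.
have [r ->] := prod_1D (index_enum 'I_n) (fun i => Z i i) t; rewrite -/(mxtrace Z).
have [r' ->] : exists r', \sum_(s : {perm 'I_n} | s != 1%g)
    (-1) ^+ s * \prod_i (1%:M + t *: Z) i (s i) = t ^+ 2 * r'.
  apply: (big_ind (fun x => exists r', x = t ^+ 2 * r')) => [|x y [u ->] [v ->]|s /eqP s1]; first by exists 0; rewrite mulr0.
    by exists (u + v); rewrite mulrDr.
  have [i si] : exists i, s i != i.
    by apply: contrapT => h; apply: s1; apply/permP => i; rewrite perm1; apply/eqP/negPn/negP => hi; apply: h; exists i.
  have ssi : s (s i) != s i by rewrite (inj_eq perm_inj).
  rewrite (bigD1 i) //= (bigD1 (s i)) //= !mxE [i == _]eq_sym (negPf si) [s i == s _]eq_sym (negPf ssi) !add0r.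
  set P := \prod_(_ | _) _; set e := (-1) ^+ _; clearbody P e.
  by exists (e * Z i (s i) * Z (s i) (s (s i)) * P); ring.
by exists (r + r'); rewrite mulrDr addrA.
Qed.

(** * The congruence filtration *)

Section Reduction.
Variables (R : idomainType) (pi : R) (k : finFieldType) (red : {rmorphism R -> k}).
Hypothesis pi_neq0 : pi != 0.
Hypothesis red_surj : forall a, exists x, red x = a.
Hypothesis red_ker : forall x, red x = 0 <-> inPow pi 1 x.
Variable n : nat.
Implicit Types (A B Z W g h x y : 'M[R]_n) (a b : 'M[k]_n) (i j m : nat).

Local Notation rmx := (map_mx red).

Lemma red_pi : red pi = 0.
Proof. by apply/red_ker; exists 1; rewrite expr1 mulr1. Qed.

Lemma rmx_surj a : exists A, rmx A = a.
Proof.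
have [f hf] := fin_all_exists red_surj.
by exists (map_mx f a); apply/matrixP => r s; rewrite !mxE hf.
Qed.

Lemma rmx_pow m Z : (0 < m)%N -> rmx (pi ^+ m *: Z) = 0.
Proof.
by case: m => // m _; apply/matrixP => r s; rewrite !mxE rmorphM rmorphXn red_pi expr0n mul0r.
Qed.

Lemma inPow_mxP m A B :
  (forall r s, inPow pi m (A r s - B r s)) <-> exists Z, A = B + pi ^+ m *: Z.
Proof.
split=> [h|[Z ->] r s]; last by exists (Z r s); rewrite !mxE addrAC subrr add0r.
have [f hf] := fin_all_exists (fun rs : 'I_n * 'I_n => h rs.1 rs.2).
exists (\matrix_(r, s) f (r, s)); apply/matrixP => r s.
by rewrite !mxE -(hf (r, s)) addrC subrK.
Qed.

Lemma rmx_eqP A B : rmx A = rmx B <-> exists Z, A = B + pi *: Z.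
Proof.
rewrite -{1}[pi]expr1; split=> [e|[Z ->]].
  apply/inPow_mxP => r s; apply/red_ker; rewrite rmorphB; apply/eqP; rewrite subr_eq0.
  by move/matrixP: e => /(_ r s); rewrite !mxE => ->.
by rewrite raddfD /= (rmx_pow Z (ltn0Sn 0)) addr0.
Qed.

Lemma rmx_inv g : g \in unitmx -> rmx (invmx g) = invmx (rmx g).
Proof.
by move=> ug; apply/esym/invmx_unique; rewrite -map_mxM mulmxV // map_mx1.
Qed.

Lemma rmx_unit g : g \in unitmx -> rmx g \in unitmx.
Proof.
move=> ug; have : rmx g *m rmx (invmx g) = 1%:M by rewrite -map_mxM mulmxV // map_mx1.
by case/mulmx1_unit.
Qed.

Lemma rmx_1D m Z : (0 < m)%N -> rmx (1%:M + pi ^+ m *: Z) = 1%:M.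
Proof. by move=> m0; rewrite raddfD /= rmx_pow // addr0 map_mx1. Qed.

Lemma commg_mxE g h : g \in unitmx -> h \in unitmx ->
  commg_mx g h = 1%:M + (g *m h - h *m g) *m (invmx g *m invmx h).
Proof.
move=> ug uh; rewrite /commg_mx mulmxBl !mulmxA mulmxK //.
by rewrite mulmxV // addrC subrK.
Qed.

(** An exact formula rather than a congruence: in characteristic 2 the bracket can itself be
    divisible by pi, and the factor V, which is 1 modulo pi, still lets the next term be read
    off. *)
Lemma commg_mx_pow i j Z W :
  (0 < i)%N -> (0 < j)%N -> 1%:M + pi ^+ i *: Z \in unitmx -> 1%:M + pi ^+ j *: W \in unitmx ->
  exists V, commg_mx (1%:M + pi ^+ i *: Z) (1%:M + pi ^+ j *: W) =
    1%:M + pi ^+ (i + j) *: ((Z *m W - W *m Z) *m V) /\ rmx V = 1%:M.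
Proof.
move=> i0 j0 ux uy; set x := 1%:M + _ in ux *; set y := 1%:M + _ in uy *.
exists (invmx x *m invmx y); split.
  rewrite commg_mxE //; congr (1%:M + _); rewrite scalemxAl; congr (_ *m _).
  have c1 (a b : 'M[R]_n) : (1%:M + a) *m (1%:M + b) - (1%:M + b) *m (1%:M + a) = a *m b - b *m a.
    rewrite !mulmxDl !mulmxDr !mul1mx !mulmx1; move: (a *m b) (b *m a) => u v.
    by apply/matrixP=> r s; rewrite !mxE; ring.
  rewrite /x /y c1 -!scalemxAl -!scalemxAr !scalerA -exprD.
  by rewrite [pi ^+ j * _]mulrC -exprD -scalerBr.
by rewrite map_mxM !rmx_inv // !rmx_1D // invmx1 mulmx1.
Qed.

Lemma trace_rmx_det1 m Z : (0 < m)%N -> \det (1%:M + pi ^+ m *: Z) = 1 -> \tr (rmx Z) = 0.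
Proof.
case: m => // m _ e; have [r er] := det_1D Z (pi ^+ m.+1); rewrite {}e in er.
rewrite trace_map_mx; apply/red_ker; exists (- pi ^+ m * r).
apply: (mulfI (expf_neq0 m.+1 pi_neq0)); apply: (addrI 1); apply: (addIr (pi ^+ m.+1 ^+ 2 * r)).
by rewrite -er !exprS expr0; ring.
Qed.

Lemma commg_mx_pow_r i g Z :
  (0 < i)%N -> g \in unitmx -> 1%:M + pi ^+ i *: Z \in unitmx ->
  exists V, commg_mx g (1%:M + pi ^+ i *: Z) = 1%:M + pi ^+ i *: V /\
    rmx V = rmx g *m rmx Z *m invmx (rmx g) - rmx Z.
Proof.
move=> i0 ug ux; set x := 1%:M + _ in ux *.
exists ((g *m Z - Z *m g) *m (invmx g *m invmx x)); split.
  rewrite commg_mxE //; congr (1%:M + _); rewrite scalemxAl; congr (_ *m _).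
  rewrite /x !mulmxDl !mulmxDr mul1mx mulmx1 -scalemxAl -scalemxAr scalerBr opprD.
  by rewrite addrACA subrr add0r.
rewrite !map_mxM raddfB /= !map_mxM !rmx_inv // rmx_1D // invmx1 mulmx1 mulmxBl.
by rewrite -(mulmxA (rmx Z)) mulmxV ?rmx_unit // mulmx1.
Qed.

Definition lev (D : 'M[R]_n -> Prop) i a :=
  exists Z, D (1%:M + pi ^+ i *: Z) /\ rmx Z = a.

Section Subgroup.
Variable D : 'M[R]_n -> Prop.
Hypotheses (D1 : D 1%:M) (DM : forall x y, D x -> D y -> D (x *m y)).
Hypotheses (DV : forall x, D x -> D (invmx x)) (DU : forall x, D x -> x \in unitmx).

Lemma lev0 i : lev D i 0.
Proof. by exists 0; rewrite scaler0 addr0 map_mx0. Qed.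

Lemma levD i a b : (0 < i)%N -> lev D i a -> lev D i b -> lev D i (a + b).
Proof.
move=> i0 [Z [DZ <-]] [W [DW <-]]; exists (Z + W + pi ^+ i *: (Z *m W)); split.
  have := DM DZ DW; congr D; rewrite mulmxDl !mulmxDr !mul1mx mulmx1 -scalemxAl -scalemxAr.
  by rewrite !scalerDr !addrA; congr (_ + _); rewrite -!addrA; congr (_ + _); rewrite addrC.
by rewrite !raddfD /= rmx_pow // addr0.
Qed.

Lemma levN i a : (0 < i)%N -> lev D i a -> lev D i (- a).
Proof.
move=> i0 [Z [DZ <-]]; set x := 1%:M + _ in DZ; have ux := DU DZ.
exists (- (Z *m invmx x)); split.
  have -> : 1%:M + pi ^+ i *: - (Z *m invmx x) = invmx x; last exact: DV.
  rewrite -{1}(mulmxV ux) scalerN scalemxAl -mulmxBl.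
  by rewrite /x addrK mul1mx.
by rewrite raddfN /= map_mxM rmx_inv // rmx_1D // invmx1 mulmx1.
Qed.

Lemma levB i a b : (0 < i)%N -> lev D i a -> lev D i b -> lev D i (a - b).
Proof. by move=> i0 ha hb; apply: levD => //; apply: levN. Qed.

Lemma levJ i a h : D h -> lev D i a -> lev D i (rmx h *m a *m invmx (rmx h)).
Proof.
move=> Dh [Z [DZ <-]]; have uh := DU Dh; exists (h *m Z *m invmx h); split.
  have := DM (DM Dh DZ) (DV Dh); congr D.
  by rewrite mulmxDr mulmx1 mulmxDl mulmxV // -scalemxAr -scalemxAl.
by rewrite !map_mxM rmx_inv.
Qed.

Hypothesis hq : (3 < #|k|)%N.
Hypothesis Dimg : forall a, \det a = 1 -> exists2 d, D d & rmx d = a.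

Lemma lev_sl i a : (0 < i)%N -> lev D i a -> ~~ is_scalar_mx a ->
  forall b, \tr b = 0 -> lev D i b.
Proof.
move=> i0; apply: sl_submodule => //; first exact: lev0.
  by move=> ? ?; apply: levB.
by move=> g b /Dimg[d Dd <-]; apply: levJ.
Qed.

Hypothesis Ddet : forall x, D x -> \det x = 1.

(** If y agrees with g modulo pi^(m+1), then y^-1 g has determinant 1, so its leading term has trace
    0 and is realized in D at level m+1. Multiplying y by that element gains one power of pi. *)
Lemma dense_of_lev : (forall i b, (0 < i)%N -> \tr b = 0 -> lev D i b) ->
  forall g, \det g = 1 -> mclosure pi D g.
Proof.
move=> hlev g dg; suff h m : exists y Z, D y /\ g = y + pi ^+ m.+1 *: Z.
  move=> m; have [y [Z [Dy e]]] := h m; exists y; split=> // r s.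
  by exists (pi * Z r s); rewrite e !mxE addrAC subrr add0r exprSr mulrA.
elim: m => [|m [y [Z [Dy e]]]].
  have [y Dy e] : exists2 d, D d & rmx d = rmx g by apply: Dimg; rewrite det_map_mx dg rmorph1.
  by have /rmx_eqP[Z eZ] := esym e; exists y, Z; rewrite expr1.
have uy := DU Dy; set V := invmx y *m Z.
have eV : invmx y *m g = 1%:M + pi ^+ m.+1 *: V by rewrite e mulmxDr mulVmx // -scalemxAr.
have tV : \tr (rmx V) = 0.
  apply: (@trace_rmx_det1 m.+1) => //.
  by rewrite -eV det_mulmx dg mulr1; apply/Ddet/DV.
have [W [DW eW]] := hlev m.+1 _ (ltn0Sn m) tV.
have /rmx_eqP[U eU] := esym eW.
exists (y *m (1%:M + pi ^+ m.+1 *: W)), (y *m U); split; first exact: DM.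
rewrite -[g](mulKVmx uy) eV eU scalerDr scalerA -exprSr addrA mulmxDr.
by rewrite !mulmxDr -!scalemxAr.
Qed.

Lemma lev_bracket i j a b : (0 < i)%N -> (0 < j)%N -> lev D i a -> lev D j b ->
  lev D (i + j) (a *m b - b *m a).
Proof.
move=> i0 j0 [Z [DZ <-]] [W [DW <-]].
have [V [eV V1]] := commg_mx_pow i0 j0 (DU DZ) (DU DW).
exists ((Z *m W - W *m Z) *m V); split.
  by rewrite -eV; apply/DM/DV => //; apply/DM/DV => //; apply: DM.
by rewrite map_mxM V1 mulmx1 raddfB /= !map_mxM.
Qed.

(** The bracket of two opposite matrix units is E_00 - E_11 up to naming. It is nonscalar if 2 is
    nonzero, or if a third diagonal position carries a 0; [lev_sl] does the rest. *)
Lemma lev_all (i0 i1 : 'I_n) : i0 != i1 ->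
  (2 : k) != 0 \/ (exists i2 : 'I_n, (i2 != i0) && (i2 != i1)) ->
  (forall b, \tr b = 0 -> lev D 1 b) -> forall i b, (0 < i)%N -> \tr b = 0 -> lev D i b.
Proof.
move=> h01 hk h1; elim=> // -[|i] IH b _; first exact: h1.
have h10 : i1 != i0 by rewrite eq_sym.
have tr_delta (r s : 'I_n) : r != s -> \tr (delta_mx r s : 'M[k]_n) = 0.
  move=> hrs; rewrite /mxtrace big1 // => t _; rewrite mxE.
  by have [->|] := eqVneq t r; rewrite ?(negPf hrs).
have := lev_bracket (ltn0Sn i) (ltn0Sn 0) (IH _ (ltn0Sn i) (tr_delta _ _ h01)) (h1 _ (tr_delta _ _ h10)).
rewrite !mul_delta_mx addn1 => /lev_sl; apply=> //.
apply/is_scalarP => -[_ hd]; case: hk => [/eqP k2|[i2 /andP[h20 h21]]].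
  apply: k2; have := hd i0 i1; rewrite !mxE !eqxx (negPf h01) (negPf h10) /= => /eqP.
  by rewrite -subr_eq0 => /eqP e; rewrite -[RHS]e; ring.
have := hd i0 i2; rewrite !mxE !eqxx (negPf h20) (negPf h21) (negPf h01) /= !subr0 => /eqP.
by rewrite oner_eq0.
Qed.
End Subgroup.
End Reduction.

(** * The case n = 2 in characteristic 2 *)

Section TwoByTwo.
Variables (K : comNzRingType).
Implicit Types A B : 'M[K]_2.

Lemma mulmx2E A B (r s : 'I_2) : (A *m B) r s = A r 0 * B 0 s + A r 1 * B 1 s.
Proof. by rewrite mxE !big_ord_recl big_ord0 addr0; congr (_ * _ + A _ _ * B _ _); apply: val_inj. Qed.

Let addE A B (r s : 'I_2) : (A + B) r s = A r s + B r s.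
Proof. by rewrite mxE. Qed.

Let subE A B (r s : 'I_2) : (A - B) r s = A r s - B r s.
Proof. by rewrite !mxE. Qed.

Let scaleE c A (r s : 'I_2) : (c *: A) r s = c * A r s.
Proof. by rewrite mxE. Qed.

Definition mx2E := (mulmx2E, subE, addE, scaleE).

Lemma mxtrace2 A : \tr A = A 0 0 + A 1 1.
Proof. by rewrite /mxtrace !big_ord_recl big_ord0 addr0; congr (_ + A _ _); apply: val_inj. Qed.

Lemma det2 A : \det A = A 0 0 * A 1 1 - A 0 1 * A 1 0.
Proof.
rewrite (expand_det_row _ 0) !big_ord_recl big_ord0 addr0 /cofactor !det_mx11 !mxE /=.
have -> : lift 0 0 = 1 :> 'I_2 by apply: val_inj.
have -> : lift 1 0 = 0 :> 'I_2 by apply: val_inj.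
by rewrite /bump /= expr0 expr1; ring.
Qed.

Lemma ord2P (P : 'I_2 -> Prop) : P 0 -> P 1 -> forall i, P i.
Proof.
move=> P0 P1 [[|[|//]] hi]; [rewrite (_ : Ordinal hi = 0) // | rewrite (_ : Ordinal hi = 1) //];
 exact: val_inj.
Qed.

End TwoByTwo.

Section CharTwo.
Variables (R : idomainType) (pi : R) (k : finFieldType) (red : {rmorphism R -> k}).
Hypothesis pi_neq0 : pi != 0.
Hypothesis red_surj : forall a, exists x, red x = a.
Hypothesis red_ker : forall x, red x = 0 <-> inPow pi 1 x.
Local Notation rmx := (map_mx red).
Variable D : 'M[R]_2 -> Prop.
Hypotheses (D1 : D 1%:M) (DM : forall x y, D x -> D y -> D (x *m y)).
Hypotheses (DV : forall x, D x -> D (invmx x)) (Ddet : forall x, D x -> \det x = 1).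
Hypothesis hq : (3 < #|k|)%N.
Hypothesis Dimg : forall a, \det a = 1 -> exists2 d, D d & rmx d = a.
Hypothesis two0 : (2 : R) = 0.
Hypothesis lev1 : forall b, \tr b = 0 -> lev pi red D 1 b.

Let DU x : D x -> x \in unitmx.
Proof. by move/Ddet/det1_unit. Qed.

Let redpi : red pi = 0.
Proof. exact: red_pi red_ker. Qed.

Let k2 : (2 : k) = 0.
Proof. by rewrite -(rmorph_nat red) two0 rmorph0. Qed.

Let X : 'M[R]_2 := delta_mx 0 1 + delta_mx 1 0.

(** Expand the 2 by 2 determinant and divide by pi^(i+2). The right-hand side is c^2 at level 1,
    where i = 0, and 0 at all higher levels. *)
Lemma trace_correction (i : nat) c Y : \det (1%:M + pi ^+ i.+1 *: (c *: X + pi *: Y)) = 1 ->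
  red (\tr Y) = red pi ^+ i * red c ^+ 2.
Proof.
rewrite det2 /X !mxE /= mxtrace2 => e.
have {}e : Y 0 0 + Y 1 1 + pi ^+ i.+2 * (Y 0 0 * Y 1 1) = pi ^+ i * ((c + pi * Y 0 1) * (c + pi * Y 1 0)).
  apply: (mulfI (expf_neq0 i.+2 pi_neq0)); apply: (addrI 1).
  move/eqP: e; rewrite -subr_eq0 => /eqP e; apply/eqP; rewrite -subr_eq0 -e; apply/eqP.
  by rewrite !exprS; ring.
have rP : red (pi ^+ i.+2) = 0 by rewrite rmorphXn redpi expr0n.
have := congr1 red e; rewrite rmorphD (rmorphM red (pi ^+ i.+2)) rP mul0r addr0 => ->.
by rewrite !rmorphM rmorphXn !(rmorphD red c) !rmorphM redpi !mul0r !addr0 expr2.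
Qed.

(* Brackets in sl_2 are scalar here.  Taking X and cX at levels 1 and i, the leading bracket vanishes and the next one is nonscalar because determinant 1 fixes the traces of the second-order terms. *)
Lemma lev_step2 i : (0 < i)%N -> (forall b, \tr b = 0 -> lev pi red D i b) ->
  forall b, \tr b = 0 -> lev pi red D i.+2 b.
Proof.
case: i => // i _ hi.
have [c' [c0 c1]] := exists_sq_neq1 hq; have [c ec] := red_surj c'.
have trX (e : k) : \tr (e *: rmx X) = 0.
  by rewrite mxtraceZ trace_map_mx mxtrace2 /X !mxE /= !addr0 rmorph0 mulr0.
have [Z [DZ eZ]] := lev1 (trX 1); have [W [DW eW]] := hi _ (trX c').
have /(rmx_eqP red_ker)[X' eX] : rmx Z = rmx (1 *: X) by rewrite eZ !scale1r.
have /(rmx_eqP red_ker)[Y eY] : rmx W = rmx (c *: X) by rewrite eW map_mxZ ec.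
have tX : red (\tr X') = 1.
  by rewrite (@trace_correction 0 1) -?eX ?Ddet // rmorph1 !expr0 expr1n mulr1.
have tY : red (\tr Y) = red pi ^+ i * c' ^+ 2.
  by rewrite (@trace_correction i c) -?eY ?Ddet // ec.
have [V [eV V1]] := commg_mx_pow red_ker (ltn0Sn 0) (ltn0Sn i) (DU DZ) (DU DW).
pose U := X *m Y - Y *m X + c *: (X' *m X - X *m X') + pi *: (X' *m Y - Y *m X').
have eU : Z *m W - W *m Z = pi *: U.
  rewrite eX eY scale1r /U; move: X => x; rewrite !mulmxDl !mulmxDr -!scalemxAl -!scalemxAr.
  move: (x *m x) (x *m Y) (Y *m x) (X' *m x) (x *m X') (X' *m Y) (Y *m X') => ? ? ? ? ? ? ?.
  by apply/matrixP=> r s; rewrite !mxE; ring.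
have hU : lev pi red D i.+3 (rmx U).
  exists (U *m V); split; last by rewrite map_mxM V1 mulmx1.
  have -> : 1%:M + pi ^+ i.+3 *: (U *m V) = commg_mx (1%:M + pi ^+ 1 *: Z) (1%:M + pi ^+ i.+1 *: W).
    by rewrite eV eU -scalemxAl scalerA -exprSr add1n.
  by apply/DM/DV => //; apply/DM/DV => //; apply: DM.
apply: (lev_sl red_ker D1 DM DV DU hq Dimg (ltn0Sn _) hU).
apply/is_scalarP => -[/(_ 0 1 isT) hoff _].
(* Modulo 2 the (0, 1) entry of U is tr Y + c tr X'. By the trace corrections it equals c(c + 1)
   when i = 0 and c otherwise; both are nonzero by the choice of c. *)
have : red (\tr Y) + c' * red (\tr X') = 0.
  have e01 : U 0 1 = Y 1 1 - Y 0 0 + c * (X' 0 0 - X' 1 1) + pi * (X' *m Y - Y *m X') 0 1.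
    by rewrite /U !mx2E /X !mxE /=; ring.
  rewrite -hoff mxE e01 !mxtrace2 !rmorphD !rmorphM redpi mul0r addr0 !rmorphB ec.
  apply/eqP; rewrite -subr_eq0.
  rewrite (_ : _ - _ = 2 * (red (Y 0 0) + c' * red (X' 1 1))); last by ring.
  by rewrite k2 mul0r.
rewrite tY tX mulr1; case: (i) => [|j].
  rewrite expr0 mul1r => /eqP; rewrite (_ : _ + _ = c' * (c' + 1)); last by ring.
  rewrite mulf_eq0 (negPf c0) /= => /eqP e.
  have : c' ^+ 2 - 1 = (c' + 1) * (c' - 1) by ring.
  by rewrite e mul0r => /eqP; rewrite subr_eq0 (negPf c1).
by rewrite redpi expr0n mul0r add0r => /eqP; rewrite (negPf c0).
Qed.

(** A' is the second-order term of an element of D with first-order term A. Once level 2 is assumed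
    scalar, A determines its residue modulo scalars. *)
Definition lift2 A A' := D (1%:M + pi *: A + pi ^+ 2 *: A').

Lemma lift2_exists A : \tr (rmx A) = 0 -> exists A', lift2 A A'.
Proof.
move=> /lev1[Z [DZ /(rmx_eqP red_ker)[A' e]]]; exists A'; move: DZ.
by rewrite e expr1 scalerDr scalerA -expr2 addrA.
Qed.

Lemma lift2M A A' B B' : lift2 A A' -> lift2 B B' ->
  exists2 C, lift2 (A + B) C & rmx C = rmx A' + rmx B' + rmx A *m rmx B.
Proof.
move=> DA DB; exists (A' + B' + A *m B + pi *: (A *m B' + A' *m B) + pi ^+ 2 *: (A' *m B')).
  have := DM DA DB; rewrite /lift2; congr D.
  rewrite !mulmxDl !mulmxDr !mul1mx !mulmx1 -!scalemxAl -!scalemxAr.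
  move: (A *m B) (A *m B') (A' *m B) (A' *m B') => ? ? ? ?.
  by apply/matrixP=> r s; rewrite !mxE; ring.
have rpi Z : rmx (pi *: Z) = 0 by rewrite map_mxZ redpi scale0r.
by rewrite !raddfD /= -map_mxM expr2 -scalerA !rpi !addr0.
Qed.

Lemma bracket_scalar2 (z a : 'M[k]_2) : \tr z = 0 -> \tr a = 0 -> is_scalar_mx (z *m a - a *m z).
Proof.
rewrite !mxtrace2 => /eqP; rewrite addr_eq0 => /eqP z0 /eqP; rewrite addr_eq0 => /eqP a0.
have h01 : (z *m a - a *m z) 0 1 = 0.
  by rewrite !mx2E z0 a0; transitivity (2 * (z 0 1 * a 1 1 - z 1 1 * a 0 1)); [ring | rewrite k2 mul0r].
have h10 : (z *m a - a *m z) 1 0 = 0.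
  by rewrite !mx2E z0 a0; transitivity (2 * (z 1 1 * a 1 0 - z 1 0 * a 1 1)); [ring | rewrite k2 mul0r].
have hd : (z *m a - a *m z) 0 0 = (z *m a - a *m z) 1 1.
  apply/eqP; rewrite -subr_eq0 !mx2E.
  rewrite (_ : _ - _ = 2 * (z 0 1 * a 1 0 - z 1 0 * a 0 1)); last by ring.
  by rewrite k2 mul0r.
by apply/is_scalarP; split=> i j; elim/ord2P: i; elim/ord2P: j.
Qed.

(** * Second-order terms under the assumption that level 2 is scalar *)

Section NoLevel2.
Hypothesis lev2 : forall a, lev pi red D 2 a -> is_scalar_mx a.

Lemma lift2_unique A A' A'' : lift2 A A' -> lift2 A A'' -> eqs (rmx A'') (rmx A').
Proof.
rewrite /lift2; set d := 1%:M + _ + _; move=> Dd Dd'; rewrite /eqs -raddfB /=; apply: lev2.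
have ud := DU Dd; exists (invmx d *m (A'' - A')); split.
  have e : 1%:M + pi *: A + pi ^+ 2 *: A'' = d + pi ^+ 2 *: (A'' - A').
    by apply/matrixP=> r s; rewrite /d !mxE; ring.
  by have := DM (DV Dd) Dd'; rewrite e mulmxDr mulVmx // -scalemxAr.
rewrite map_mxM rmx_inv // (_ : rmx d = 1%:M) ?invmx1 ?mul1mx //.
by rewrite /d !raddfD /= expr2 -scalerA !map_mxZ redpi !scale0r !addr0 map_mx1.
Qed.

(** The matrix g need not lie in D, so one conjugates by some h = g + pi W in D. The error is a
    conjugate of the bracket of g^-1 W with A; both have trace 0 modulo pi, so it is scalar in
    characteristic 2. *)
Lemma lift2J g A A' : \det g = 1 -> \tr (rmx A) = 0 -> lift2 A A' ->
  exists2 C, lift2 (g *m A *m invmx g) C & eqs (rmx C) (rmx g *m rmx A' *m invmx (rmx g)).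
Proof.
move=> dg tA DA; have ug := det1_unit dg.
have [h Dh /(rmx_eqP red_ker)[W eW]] : exists2 h, D h & rmx h = rmx g.
  by apply: Dimg; rewrite det_map_mx dg rmorph1.
have uh := DU Dh; set B := g *m A *m invmx g.
exists (h *m A' *m invmx h + (W *m A - B *m W) *m invmx h).
  have := DM (DM Dh DA) (DV Dh); rewrite /lift2; congr D.
  have eh : h *m A = B *m h + pi *: (W *m A - B *m W).
    rewrite {1 2}eW mulmxDl mulmxDr /B mulmxKV // -scalemxAl -scalemxAr scalerBr.
    by rewrite -[RHS]addrA [_ + (_ - _)]addrC subrK.
  move: (W *m A - B *m W) eh => U eh.
  rewrite !mulmxDr mulmx1 !mulmxDl mulmxV // -!scalemxAr eh -!scalemxAl mulmxDl mulmxK //.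
  rewrite -scalemxAl !scalerDr scalerA -expr2 -!addrA; congr (_ + _).
  by congr (_ + _); rewrite addrC.
have tz : \tr (rmx (invmx g *m W)) = 0.
  apply: (@trace_rmx_det1 _ _ _ _ pi_neq0 red_ker _ 1) => //.
  have -> : 1%:M + pi ^+ 1 *: (invmx g *m W) = invmx g *m h.
    by rewrite eW mulmxDr mulVmx // -scalemxAr expr1.
  by rewrite det_mulmx det_inv dg Ddet // invr1 mulr1.
have erh : rmx h = rmx g by apply/(rmx_eqP red_ker); exists W.
rewrite /eqs !raddfD /= !map_mxM !rmx_inv // erh addrAC subrr add0r raddfB /= !map_mxM rmx_inv //.
have ug' := rmx_unit red ug.
suff -> : (rmx W *m rmx A - rmx g *m rmx A *m invmx (rmx g) *m rmx W) *m invmx (rmx g) =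
  rmx g *m (rmx (invmx g *m W) *m rmx A - rmx A *m rmx (invmx g *m W)) *m invmx (rmx g).
  by apply: scalarJ; [exact: mulmxV | exact: bracket_scalar2].
congr (_ *m _); rewrite map_mxM rmx_inv // mulmxBr !mulmxA mulmxV // mul1mx //.
Qed.

Lemma lift2_fix g A A' : \det g = 1 -> \tr (rmx A) = 0 -> g *m A = A *m g -> lift2 A A' ->
  eqs (rmx g *m rmx A' *m invmx (rmx g)) (rmx A').
Proof.
move=> dg tA gA DA; have [C DC hC] := lift2J dg tA DA.
move: DC; rewrite gA mulmxK ?det1_unit // => DC.
exact: eqs_trans (eqs_sym hC) (lift2_unique DA DC).
Qed.

(* The second-order terms of E_01, E_10 and 1 are constrained by commuting elements of SL_2; conjugating E_01 by 1 + E_10 gives E_01 + E_10 + 1, and the two resulting second-order terms differ by 1 at the entry (0, 1). *)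
Lemma level2_contradiction : False.
Proof.
have trd : \tr (rmx (delta_mx 0 1 : 'M[R]_2)) = 0 /\ \tr (rmx (delta_mx 1 0 : 'M[R]_2)) = 0.
  by split; rewrite mxtrace2 !mxE /= rmorph0 addr0.
have trI : \tr (rmx (1%:M : 'M[R]_2)) = 0 by rewrite mxtrace2 !mxE /= rmorph1.
have [M' LM] := lift2_exists trd.1; have [N' LN] := lift2_exists trd.2.
have [L' LL] := lift2_exists trI.
have rmx_elem (i j : 'I_2) b : rmx (elem i j b) = elem i j (red b).
  by rewrite /elem raddfD /= map_mx1 map_mxZ map_delta_mx.
have fixE (i j : 'I_2) b A A' : i != j -> \tr (rmx A) = 0 ->
    (forall b', elem i j b' *m A = A *m elem i j b') -> lift2 A A' ->
    eqs (elem i j b *m rmx A' *m elem i j (- b)) (rmx A').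
  move=> hij tA cA LA; have [b' <-] := red_surj b.
  by have := lift2_fix (det_elem b' hij) tA (cA b') LA; rewrite rmx_elem invmx_elem.
have [c [c0 c2]] := exists_sq_neq1 hq.
(* Invariance at b = 1 gives A_jj - A_ii = A_ji; substituted at b = c it gives c (c - 1) A_ji =
   0. *)
have key (i j : 'I_2) (A : 'M[k]_2) : i != j -> (forall b, eqs (elem i j b *m A *m elem i j (- b)) A) -> A j i = 0.
  move=> hij hA; have e b := eqs_off (hA b) hij.
  have e1 := e 1; have e2 := e c; rewrite !elem_conj !eqxx in e1 e2.
  have ejj : A j j - A i i = A j i.
    apply/eqP; rewrite -subr_eq0; move/eqP: e1; rewrite -subr_eq0 => /eqP <-.
    by rewrite /=; apply/eqP; ring.
  have : c * (c - 1) * A j i = 0.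
    move/eqP: e2; rewrite -subr_eq0 -ejj => /eqP e2.
    by apply: oppr_inj; rewrite oppr0 -[RHS]e2 /=; ring.
  move/eqP; rewrite !mulf_eq0 (negPf c0) subr_eq0 /= => /orP[/eqP c1|/eqP//].
  by rewrite c1 expr1n eqxx in c2.
have com01 b : elem 0 1 b *m delta_mx 0 1 = delta_mx 0 1 *m elem 0 1 b :> 'M[R]_2.
  by rewrite /elem mulmxDl mulmxDr mul1mx mulmx1 -scalemxAl -scalemxAr.
have com10 b : elem 1 0 b *m delta_mx 1 0 = delta_mx 1 0 *m elem 1 0 b :> 'M[R]_2.
  by rewrite /elem mulmxDl mulmxDr mul1mx mulmx1 -scalemxAl -scalemxAr.
have N01 : rmx N' 0 1 = 0.
  by apply: (key 1 0) => // b; apply: fixE LN => //; exact: trd.2.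
have L01 : rmx L' 0 1 = 0.
  by apply: (key 1 0) => // b; apply: fixE LL => // b'; rewrite mulmx1 mul1mx.
have [C LC hC] := lift2J (det_elem (1 : R) (isT : (1 : 'I_2) != 0)) trd.1 LM.
have [C1 LC1 eC1] := lift2M LM LN; have [C2 LC2 eC2] := lift2M LC1 LL.
have eB : elem 1 0 1 *m delta_mx 0 1 *m invmx (elem 1 0 1) = delta_mx 0 1 + delta_mx 1 0 + 1%:M :> 'M[R]_2.
  rewrite invmx_elem //; apply/matrixP=> r s; rewrite elem_conj; apply/eqP; rewrite -subr_eq0.
  elim/ord2P: r; elim/ord2P: s; rewrite !mxE /=; apply/eqP;
    by [ring | transitivity (2 * (-1) : R); [ring | rewrite two0 mul0r]].
rewrite eB in LC; have /eqs_off/(_ (isT : (0 : 'I_2) != 1)) := eqs_trans (eqs_sym hC) (lift2_unique LC2 LC).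
rewrite rmx_elem rmorph1 invmx_elem // elem_conj eC2 eC1 !mx2E N01 L01 !mxE /=.
rewrite !addr0 !rmorph0 !rmorph1 => /eqP; rewrite -subr_eq0 (_ : _ - _ = -1); last by ring.
by rewrite oppr_eq0 oner_eq0.
Qed.
End NoLevel2.

Lemma lev2_sl b : \tr b = 0 -> lev pi red D 2 b.
Proof.
move: b; suff [a [ha na]] : exists a, lev pi red D 2 a /\ ~~ is_scalar_mx a.
  exact: (lev_sl red_ker D1 DM DV DU hq Dimg (ltn0Sn 1) ha na).
apply: contrapT => hn; apply: level2_contradiction => a ha.
by apply/negPn/negP => na; apply: hn; exists a.
Qed.

(** As [lev_step2] advances by two levels, the induction carries two consecutive ones, starting from
    levels 1 and 2. *)
Lemma lev_all_char2 i b : (0 < i)%N -> \tr b = 0 -> lev pi red D i b.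
Proof.
suff h j : (forall b, \tr b = 0 -> lev pi red D j.+1 b) /\ (forall b, \tr b = 0 -> lev pi red D j.+2 b).
  by case: i => // i _; apply: (h i).1.
elim: j => [|j [IH1 IH2]]; first by split; [exact: lev1 | exact: lev2_sl].
by split=> //; apply: lev_step2.
Qed.
End CharTwo.

(** On the basis of matrix units, E_ij contributes h_ii (h^-1)_jj to the trace. *)
Lemma TrAdE (R : idomainType) (n : nat) (h : 'M[R]_n) : TrAd h = \tr h * \tr (invmx h).
Proof.
rewrite /TrAd [LHS](reindex _ (curry_mxvec_bij n n)) /= /mxtrace mulr_suml.
rewrite (eq_bigr (fun p : 'I_n * 'I_n => h p.1 p.1 * invmx h p.2 p.2)) => [|[i j] _].
  rewrite -(pair_bigA _ (fun i j => h i i * invmx h j j)) /=.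
  by apply: eq_bigr => i _; rewrite mulr_sumr.
rewrite /lin_mx mxE /= vec_mx_delta mxvecE mxE (bigD1 j) //= mul_delta_r eqxx mulr1 big1 ?addr0 //.
by move=> l /negPf hl; rewrite mul_delta_r hl mulr0 mul0r.
Qed.

(** * The Frobenius lift *)

Section Frobenius.
Variables (R : idomainType) (pi : R) (k : finFieldType) (red : {rmorphism R -> k}) (p : nat).
Hypothesis pi_neq0 : pi != 0.
Hypothesis pi_nonunit : pi \isn't a GRing.unit.
Hypothesis red_surj : forall a, exists x, red x = a.
Hypothesis red_ker : forall x, red x = 0 <-> inPow pi 1 x.
Hypothesis pchar : p \in [pchar R].
Hypothesis hq : (9 < #|k|)%N.

(* Since R has characteristic p, the map x |-> x^q is an endomorphism of R that induces the identity on the residue field and kills pi modulo pi^2: its image modulo pi^2 is a copy of k. *)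
Lemma frobenius_lift : exists s : {rmorphism R -> R},
  (forall x, red (s x) = red x) /\ (forall x y, red x = red y -> inPow pi 2 (s x - s y)).
Proof.
have hpk := rmorph_pchar red pchar; have pp := pcharf_prime pchar.
have eq : #|k| = (p ^ logn p #|pPrimeCharType hpk|)%N := card_pprimeChar hpk.
have qnat : [pchar R]%R.-nat #|k|.
  by rewrite eq pnatX (eq_pnat _ (pcharf_eq pchar)) pnat_id.
pose f (x : R) := x ^+ #|k|.
have fB : zmod_morphism f.
  move=> x y; apply/eqP; rewrite eq_sym subr_eq eq_sym; apply/eqP.
  by rewrite /f -(exprDn_pchar _ _ qnat) subrK.
have fM : monoid_morphism f by split=> [|x y]; rewrite /f ?expr1n ?exprMn.
pose s : {rmorphism R -> R} := HB.pack_for {rmorphism R -> R} f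
  (GRing.isZmodMorphism.Build R R f fB) (GRing.isMonoidMorphism.Build R R f fM).
have sE x : s x = x ^+ #|k| by [].
exists s; split=> [x|x y e]; first by rewrite sE rmorphXn expf_card.
have /red_ker[z ez] : red (x - y) = 0 by rewrite rmorphB e subrr.
rewrite -rmorphB sE ez expr1 exprMn; exists (pi ^+ (#|k| - 2) * z ^+ #|k|).
by rewrite mulrA -exprD subnKC // (leq_trans _ hq).
Qed.

Variable m : nat.
Local Notation n := m.+1.
Local Notation rmx := (map_mx red).
Variable H : 'M[R]_n -> Prop.
Hypotheses (HM : forall x y, H x -> H y -> H (x *m y)).
Hypotheses (HV : forall x, H x -> H (invmx x)) (HU : forall x, H x -> x \in unitmx).
Hypothesis Himg : forall a, \det a = 1 -> exists2 d, H d & rmx d = a.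
Hypothesis lev_scalar : forall a, lev pi red H 1 a -> is_scalar_mx a.

Variable s : {rmorphism R -> R}.
Hypothesis red_s : forall x, red (s x) = red x.
Hypothesis s_red : forall x y, red x = red y -> inPow pi 2 (s x - s y).
Local Notation smx := (map_mx s).
Implicit Types (g h Z W : 'M[R]_n).

Let rmx_s h : rmx (smx h) = rmx h.
Proof. by apply/matrixP=> i j; rewrite !mxE red_s. Qed.

Let smx_unit h : H h -> smx h \in unitmx.
Proof. by move=> /HU; rewrite !unitmxE det_map_mx; apply: rmorph_unit. Qed.

Let rpi Z : rmx (pi *: Z) = 0.
Proof. by rewrite map_mxZ (red_pi red_ker) scale0r. Qed.

Let decomp h : H h -> exists Z, h = smx h *m (1%:M + pi *: Z).
Proof.
move=> Hh; have /(rmx_eqP red_ker)[W eW] : rmx h = rmx (smx h) by rewrite rmx_s.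
exists (invmx (smx h) *m W).
by rewrite mulmxDr mulmx1 -scalemxAr mulKVmx ?smx_unit.
Qed.

(** If h and h' agree modulo pi, then s(h) and s(h') agree modulo pi^2, so h^-1 h' is 1 + pi V with
    V = Z' - Z modulo pi, and level 1 of H is scalar. Hence Z depends, modulo scalars, only on the
    residue of h. *)
Let decomp_unique h h' Z Z' : H h -> H h' -> rmx h = rmx h' ->
  h = smx h *m (1%:M + pi *: Z) -> h' = smx h' *m (1%:M + pi *: Z') -> eqs (rmx Z') (rmx Z).
Proof.
move=> Hh Hh' e eh eh'; rewrite /eqs -raddfB /=; apply: lev_scalar.
have /inPow_mxP[U eU] : forall i j, inPow pi 2 (smx h' i j - smx h i j).
  by move=> i j; rewrite !mxE; apply: s_red; move/matrixP: e => /(_ i j); rewrite !mxE.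
have uh := HU Hh.
set V := invmx h *m (smx h *m (Z' - Z) + pi *: (U *m (1%:M + pi *: Z'))).
have eV : h' = h + pi *: (smx h *m (Z' - Z) + pi *: (U *m (1%:M + pi *: Z'))).
  rewrite {1}eh' eU {2}eh mulmxDl !mulmxDr !mulmx1 mulmxN.
  rewrite -!scalemxAr -!scalemxAl expr2; move: (smx h) (smx h *m Z) (smx h *m Z') (U *m Z') => ? ? ? ?.
  by apply/matrixP=> i j; rewrite !mxE; ring.
exists V; split.
  have := HM (HV Hh) Hh'; congr H.
  by rewrite {1}eV [LHS]mulmxDr mulVmx // -scalemxAr expr1.
rewrite /V map_mxM raddfD /= rpi addr0 map_mxM rmx_s -map_mxM -map_mxM mulmxA mulVmx //.
by rewrite mul1mx.
Qed.

Let G a := exists2 h, H h & rmx h = a.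

Lemma frobenius_cocycle : exists X, cocycle G X /\
  forall h Z, H h -> h = smx h *m (1%:M + pi *: Z) -> eqs (rmx Z) (X (rmx h)).
Proof.
have hX (a : 'M[k]_n) : exists X, forall h Z, H h -> rmx h = a -> h = smx h *m (1%:M + pi *: Z) ->
    eqs (rmx Z) X.
  (* Outside the image of H the value 0 is arbitrary: the cocycle condition concerns G only. *)
  have [[h Hh e]|no] := EM (G a); last by exists 0 => h Z Hh e; case: no; exists h.
  have [Z eZ] := decomp Hh; exists (rmx Z) => h' Z' Hh' e' eZ'.
  by apply: (decomp_unique Hh Hh' _ eZ eZ'); rewrite e e'.
have [X {}hX] := fin_all_exists hX; exists X; split; last first.
  by move=> h Z Hh eZ; apply: hX eZ.
move=> _ _ [g Hg <-] [h Hh <-].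
have [Z eZ] := decomp Hg; have [W eW] := decomp Hh.
have us := smx_unit Hh.
pose C := invmx (smx h) *m Z *m smx h.
have Hgh := HM Hg Hh.
have egh : g *m h = smx (g *m h) *m (1%:M + pi *: (C + W + pi *: (C *m W))).
  rewrite {1}eZ {1}eW map_mxM.
  have -> : smx g *m (1%:M + pi *: Z) *m (smx h *m (1%:M + pi *: W)) =
    smx g *m smx h *m ((1%:M + pi *: C) *m (1%:M + pi *: W)).
    rewrite !mulmxA; congr (_ *m _); rewrite -!mulmxA; congr (_ *m _).
    by rewrite mulmxDl mulmxDr mul1mx mulmx1 -scalemxAl -scalemxAr /C !mulmxA mulmxV // mul1mx.
  congr (_ *m _); rewrite mulmxDl !mulmxDr !mul1mx mulmx1 -scalemxAl -scalemxAr.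
  move: (C *m W) => u; move: (C) => c.
  by apply/matrixP=> i j; rewrite !mxE; ring.
rewrite -map_mxM.
apply: eqs_trans (eqs_sym (hX _ _ _ Hgh erefl egh)) _.
rewrite !raddfD /= rpi addr0; apply: eqsD; last exact: hX eW.
rewrite /C !map_mxM (rmx_inv _ us) rmx_s; apply: eqsJ; last exact: hX eZ.
by rewrite mulVmx // rmx_unit ?HU.
Qed.

(** Triviality of the cocycle gives Z = Y' - S^-1 Y' S + c modulo pi, with S = s(h). The terms in Y'
    become commutators under the trace, so modulo pi^2 one has tr h = (1 + pi c) tr S and tr h^-1 =
    (1 - pi c) tr S^-1, and the scalar cancels in the product. *)
Lemma trace_frobenius h : H h -> inPow pi 2 (s (TrAd h) - TrAd h).
Proof.
have [X [cX hX]] := frobenius_cocycle.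
have GU a : G a -> a \in unitmx by case=> g Hg <-; rewrite rmx_unit ?HU.
have GM a b : G a -> G b -> G (a *m b).
  by move=> [g Hg <-] [g' Hg' <-]; exists (g *m g'); [exact: HM | rewrite map_mxM].
have GS a : \det a = 1 -> G a by move=> /Himg.
have [Y hY] := cocycle_trivial hq GU GM GS cX.
move=> Hh; have [Z eZ] := decomp Hh; have uh := HU Hh; have us := smx_unit Hh.
have [Y' eY'] := rmx_surj red_surj Y.
have : is_scalar_mx (rmx Z - cobound Y (rmx h)).
  have := scalarD (hX _ _ Hh eZ) (hY _ (ex_intro2 _ _ h Hh erefl)).
  by rewrite addrA subrK.
case/is_scalar_mxP => c' ec; have [c ec'] := red_surj c'.
set S := smx h in us eZ.
have /(rmx_eqP red_ker)[V eV] : rmx Z = rmx (Y' - invmx S *m Y' *m S + c%:M).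
  rewrite raddfD /= raddfB /= map_scalar_mx ec' -ec !map_mxM (rmx_inv _ us) rmx_s eY'.
  by rewrite addrC subrK.
have tr1 : \tr (S *m Z) = c * \tr S + pi * \tr (S *m V).
  have -> : S *m Z = S *m Y' - Y' *m S + c *: S + pi *: (S *m V).
    by rewrite eV !mulmxDr mulmxN !mulmxA mulmxV // mul1mx mul_mx_scalar -scalemxAr.
  by rewrite !mxtraceD !mxtraceZ linearN /= mxtrace_mulC subrr add0r.
set T := invmx S.
have tr2 : \tr (Z *m T) = c * \tr T + pi * \tr (V *m T).
  have -> : Z *m T = Y' *m T - T *m Y' + c *: T + pi *: (V *m T).
    by rewrite eV !mulmxDl mulNmx -!mulmxA (mulmxV us : S *m T = 1%:M) mulmx1 mul_scalar_mx -scalemxAl.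
  by rewrite !mxtraceD !mxtraceZ linearN /= mxtrace_mulC subrr add0r.
set I := invmx h.
(* Second-order expansion of the inverse, obtained by substituting the exact identity T = I + pi Z I
   into itself. *)
have eI : I = T - pi *: (Z *m T) + pi ^+ 2 *: (Z *m Z *m I).
  have e : T = I + pi *: (Z *m I).
    have -> : I + pi *: (Z *m I) = (1%:M + pi *: Z) *m I by rewrite mulmxDl mul1mx -scalemxAl.
    have -> : 1%:M + pi *: Z = T *m h by rewrite {1}eZ mulmxA (mulVmx us : T *m S = 1%:M) mul1mx.
    by rewrite -mulmxA (mulmxV uh : h *m I = 1%:M) mulmx1.
  rewrite {2}e mulmxDr -scalemxAr mulmxA {1}e; move: (Z *m I) (Z *m Z *m I) => u v.
  by apply/matrixP=> i j; rewrite !mxE; ring.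
have e1 : \tr h = (1 + pi * c) * \tr S + pi ^+ 2 * \tr (S *m V).
  by rewrite {1}eZ mulmxDr mulmx1 -scalemxAr mxtraceD mxtraceZ tr1; ring.
have e2 : \tr I = (1 - pi * c) * \tr T + pi ^+ 2 * (\tr (Z *m Z *m I) - \tr (V *m T)).
  by rewrite {1}eI !mxtraceD linearN /= !mxtraceZ tr2; ring.
rewrite !TrAdE rmorphM.
have -> : s (\tr h) = \tr S by rewrite trace_map_mx.
have -> : s (\tr I) = \tr T.
  rewrite -trace_map_mx; congr (\tr _); apply/esym/invmx_unique.
  by rewrite -map_mxM mulmxV // map_mx1.
rewrite e1 e2; set u := \tr (S *m V); set v := \tr (Z *m Z *m I) - \tr (V *m T).
set x := \tr S; set y := \tr T.
exists (c ^+ 2 * x * y - (1 + pi * c) * x * v - (1 - pi * c) * y * u - pi ^+ 2 * u * v); ring.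
Qed.

Lemma frobenius_contradiction : top_generates pi (fun x => exists2 h, H h & x = TrAd h) -> False.
Proof.
move=> htr; have := htr (fun x => inPow pi 2 (s x - x)).
have sPow x : inPow pi 2 x -> inPow pi 2 (s x).
  move=> [y ->]; have := s_red (x := pi ^+ 2 * y) (y := 0).
  rewrite !rmorph0 subr0; apply.
  by apply/red_ker; exists (pi * y); rewrite expr1 expr2 mulrA.
case/(_ _ _ _ pi).
- split=> [|x y hx hy|x y hx hy].
  + by rewrite rmorph1 subrr; apply: inPow0.
  + rewrite rmorphB (_ : _ - _ = s x - x - (s y - y)); last by ring.
    exact: inPowB.
  + rewrite rmorphM (_ : _ - _ = s x * (s y - y) + y * (s x - x)); last by ring.
    by apply: inPowD; apply: inPowM.
- move=> x /(_ 2%N)[y [hy hxy]].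
  rewrite (_ : s x - x = s (x - y) + (s y - y) - (x - y)); last by rewrite rmorphB; ring.
  by apply: inPowB => //; apply: inPowD => //; apply: sPow.
- by move=> x [h Hh ->]; apply: trace_frobenius.
(* Test element pi: since s(pi) is 0 modulo pi^2, membership in the subring would put pi in pi^2 R
   and make it a unit. *)
move=> y; have := s_red (x := pi) (y := 0); rewrite !rmorph0 subr0 (red_pi red_ker).
case=> // z -> e; case/negP: pi_nonunit; apply/unitrPr; exists (z - y).
apply: (mulfI pi_neq0); rewrite mulr1 mulrA -expr2 mulrBr -e; ring.
Qed.
End Frobenius.

(** * The derived group *)

Section DerivedGroup.
Variables (R : idomainType) (n : nat) (H : 'M[R]_n -> Prop).
Hypothesis HU : forall x, H x -> x \in unitmx.

Lemma derived_det x : derived H x -> \det x = 1.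
Proof.
elim=> [|g h Hg Hh|{}x y _ dx _ dy]; rewrite ?det1 //; last by rewrite det_mulmx dx dy mulr1.
have ug := HU Hg; have uh := HU Hh; rewrite unitmxE in ug; rewrite unitmxE in uh.
by rewrite /commg_mx !det_mulmx !det_inv [\det g * _]mulrC mulrK // divrr.
Qed.

(** The inductive [derived] has no constructor for inverses; the inverse of the commutator of g and
    h is that of h and g. *)
Lemma derived_inv x : derived H x -> derived H (invmx x).
Proof.
move=> Dx; suff [] : derived H (invmx x) /\ x \in unitmx by [].
elim: Dx => [|g h Hg Hh|{}x y _ [dx ux] _ [dy uy]].
- by rewrite invmx1 unitmx1; split=> //; apply: derived1.
- have ug := HU Hg; have uh := HU Hh.
  rewrite /commg_mx !unitmx_mul !unitmx_inv ug uh; split=> //.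
  suff -> : invmx (g *m h *m invmx g *m invmx h) = commg_mx h g by apply: derivedC.
  apply: invmx_unique; rewrite /commg_mx !mulmxA mulmxKV //.
  by rewrite mulmxKV // mulmxK // mulmxV.
- by rewrite invmxM // unitmx_mul ux uy; split=> //; apply: derivedM.
Qed.

End DerivedGroup.

(** * Residual image and first level of the derived group *)

Section Base.
Variables (R : idomainType) (pi : R) (k : finFieldType) (red : {rmorphism R -> k}).
Hypothesis red_ker : forall x, red x = 0 <-> inPow pi 1 x.
Hypothesis hq : (3 < #|k|)%N.
Variables (n : nat) (H : 'M[R]_n -> Prop).
Local Notation rmx := (map_mx red).
Hypotheses (H1 : H 1%:M) (HM : forall x y, H x -> H y -> H (x *m y)).
Hypotheses (HV : forall x, H x -> H (invmx x)) (HU : forall x, H x -> x \in unitmx).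
Hypothesis Himg : forall a : 'M[k]_n, \det a = 1 -> exists2 d, H d & rmx d = a.

Let elem_commg (i j : 'I_n) (c b : k) : i != j -> c != 0 ->
  commg_mx (torus (coroot i j c)) (elem i j b) = elem i j ((c ^+ 2 - 1) * b).
Proof.
move=> hij c0; have hd := prod_coroot hij c0; have d0 := prod1_neq0 hd.
rewrite /commg_mx torus_elem // mulmxK; last by rewrite det1_unit // det_torus.
rewrite invmx_elem // elemD //; congr elem.
by rewrite /coroot !eqxx [j == i]eq_sym (negPf hij) invrK; ring.
Qed.

(** SL_n(k) is perfect: the commutator of the coroot of c with e_ij(b) is e_ij((c^2 - 1) b), and c^2
    differs from 1. Both entries of the commutator lift to H. *)
Lemma derived_img (a : 'M[k]_n) : \det a = 1 -> exists2 d, derived H d & rmx d = a.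
Proof.
apply: (sl_generated (P := fun a => exists2 d, derived H d & rmx d = a)).
- by exists 1%:M; [exact: derived1 | rewrite map_mx1].
- move=> _ _ [x Dx <-] [y Dy <-]; exists (x *m y); [exact: derivedM | exact: map_mxM].
- move=> i j b hij; have [c [c0 c2]] := exists_sq_neq1 hq.
  have [g Hg eg] : exists2 d, H d & rmx d = torus (coroot i j c).
    by apply: Himg; rewrite det_torus prod_coroot.
  have [h Hh eh] : exists2 d, H d & rmx d = elem i j (b / (c ^+ 2 - 1)).
    by apply: Himg; rewrite det_elem.
  exists (commg_mx g h); first exact: derivedC.
  rewrite /commg_mx !map_mxM !rmx_inv ?HU // eg eh -/(commg_mx _ _) elem_commg //.
  by rewrite mulrC divfK // subr_eq0.
Qed.

(** Brackets of level 1 with itself would land in level 2. Instead an element of H over a coroot is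
    commuted with one of level 1 over E_01: this stays in level 1 and yields (c^2 - 1) E_01, which
    is not scalar. *)
Lemma derived_lev1 (i0 i1 : 'I_n) a : i0 != i1 ->
  lev pi red H 1 a -> ~~ is_scalar_mx a ->
  forall b, \tr b = 0 -> lev pi red (derived H) 1 b.
Proof.
move=> h01 ha na.
have hH := lev_sl red_ker H1 HM HV HU hq Himg (ltn0Sn 0) ha na.
have [c [c0 c2]] := exists_sq_neq1 hq.
have td : \tr (delta_mx i0 i1 : 'M[k]_n) = 0.
  rewrite /mxtrace big1 // => t _; rewrite mxE; have [->|] := eqVneq t i0; by rewrite ?(negPf h01).
have hd := prod_coroot h01 c0; have d0 := prod1_neq0 hd.
have [Z [HZ eZ]] := hH _ td.
have [g Hg eg] : exists2 d, H d & rmx d = torus (coroot i0 i1 c) by apply: Himg; rewrite det_torus.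
have [V [eV rV]] := commg_mx_pow_r red_ker (ltn0Sn 0) (HU Hg) (HU HZ).
have DV : lev pi red (derived H) 1 (rmx V).
  by exists V; split=> //; rewrite -eV; apply: derivedC.
have DU x : derived H x -> x \in unitmx by move/(derived_det HU)/det1_unit.
apply: (lev_sl red_ker (derived1 H) (@derivedM _ _ H) (derived_inv HU) DU hq derived_img (ltn0Sn 0) DV).
apply/is_scalarP => -[/(_ i0 i1 h01) e _]; move: e.
rewrite rV eg eZ invmx_torus // mxE torus_mulr torus_mull !mxE !eqxx mulr1.
rewrite /coroot !eqxx [i1 == i0]eq_sym (negPf h01) invrK -expr2 => /eqP.
by rewrite subr_eq0 (negPf c2).
Qed.

End Base.

Theorem mainTheorem16 (R : idomainType) (pi : R)
  (hdvr : is_dvr pi) (hcomplete : complete_dvr pi)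
  (hequichar : exists p : nat, p \in [pchar R])
  (hres : residue_finite_card_gt pi 9)
  (n : nat) (hn : (2 <= n)%N) (H : 'M[R]_n -> Prop)
  (hH : closed_subgroup pi H)
  (himg : image_contains_SLk pi H)
  (htr : top_generates pi (fun x => exists2 h, H h & x = TrAd h)) :
  forall g : 'M[R]_n, Hder pi H g <-> \det g = 1.
Proof.
have [pi_neq0 pi_nonunit fact] := hdvr.
have [k [red [red_surj red_ker hq]]] := residue_field hdvr hres.
have hq3 : (3 < #|k|)%N by apply: leq_trans hq.
have [HU H1 HM HV _] := hH.
have Himg (a : 'M[k]_n) : \det a = 1 -> exists2 d, H d & map_mx red d = a.
  have [A <-] := rmx_surj red_surj a => dA.
  have : inPow pi 1 (\det A - 1).
    by apply/red_ker; rewrite rmorphB rmorph1 -det_map_mx dA subrr.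
  case/himg => h Hh eh; exists h => //.
  apply/matrixP => i j; have /red_ker := eh i j; rewrite rmorphB !mxE => /eqP.
  by rewrite subr_eq0 => /eqP.
have Ddet := derived_det HU.
move=> g; split=> [Dg|].
  (* The ideals generated by the powers of pi meet in 0, since a nonzero element is a unit times
     some pi^m. Determinant 1 therefore passes from the derived group to its closure. *)
  have sep x : (forall m, inPow pi m x) -> x = 0.
    move=> hx; apply: contrapT => /eqP x0; have [u [m [uu e]]] := fact x x0.
    have [y ey] := hx m.+1; case/negP: pi_nonunit.
    have eu : u = pi * y.
      by apply: (mulIf (expf_neq0 m pi_neq0)); rewrite -e ey exprS; ring.
    by move: uu; rewrite eu unitrM => /andP[].
  apply/eqP; rewrite -subr_eq0; apply/eqP/sep => m.
  have [y [Dy /inPow_mxP[Z ->]]] := Dg m.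
  have uy := det1_unit (Ddet _ Dy).
  have -> : y + pi ^+ m *: Z = y *m (1%:M + pi ^+ m *: (invmx y *m Z)).
    by rewrite mulmxDr mulmx1 -scalemxAr mulKVmx.
  have [r er] := det_1D (invmx y *m Z) (pi ^+ m).
  by rewrite det_mulmx Ddet // mul1r er; exists (\tr (invmx y *m Z) + pi ^+ m * r); ring.
move=> dg.
case: n hn H hH himg htr HU H1 HM HV Himg Ddet g dg => [|[|n]] // _ H hH himg htr HU H1 HM HV Himg Ddet g dg.
have h01 : (0 : 'I_n.+2) != 1 by [].
have [a [ha na]] : exists a, lev pi red H 1 a /\ ~~ is_scalar_mx a.
  apply: contrapT => hn; have [p hp] := hequichar.
  have [s [s1 s2]] := frobenius_lift red_ker hp hq.
  apply: (frobenius_contradiction pi_neq0 pi_nonunit red_surj red_ker hq HM HV HU Himg _ s1 s2 htr).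
  by move=> a ha; apply/negPn/negP => na; apply: hn; exists a.
have lev1 := derived_lev1 red_ker hq3 H1 HM HV HU Himg h01 ha na.
have D1 := derived1 H; have DM := @derivedM _ _ H; have DV := derived_inv HU.
have DU x : derived H x -> x \in unitmx by move/Ddet/det1_unit.
have Dimg := derived_img hq3 HU Himg.
apply: (dense_of_lev pi_neq0 red_ker DM DV DU Dimg Ddet) dg => i b.
(* [lev_all] covers every case except residue characteristic 2 with matrices of size 2; with a third
   index available it applies in characteristic 2 as well. *)
have [k2|k2] := eqVneq (2 : k) 0; last by apply: (lev_all _ _ _ _ _ _ _ h01) => //; left.
case: n H hH himg htr HU H1 HM HV Himg Ddet g h01 a ha na lev1 D1 DM DV DU Dimg b => [|n]
  H hH himg htr HU H1 HM HV Himg Ddet g h01 a ha na lev1 D1 DM DV DU Dimg b.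
  have two0 : (2 : R) = 0.
    (* R and k have the same characteristic, so 2 = 0 lifts from k to R. *)
    have [p hp] := hequichar; have hpk := rmorph_pchar red hp.
    have : (p %| 2)%N by rewrite (dvdn_pcharf hpk) k2.
    by rewrite dvdn_prime2 ?(pcharf_prime hp) // => /eqP p2; rewrite -(pcharf0 hp) p2.
  exact: lev_all_char2.
apply: (lev_all _ _ _ _ _ _ _ h01) => //; right.
by exists (lift 0 (lift 0 0)).
Qed.
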